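(* Let $\{\psi(\nu),\nu\in\mathcal V\}$ be an $\alpha$-permanental field with kernel $u$, let $\|\cdot\|$ be a proper norm for $u$, and let $\mathcal V\subseteq\mathcal M_{\|\cdot\|}$. Assume that there exists a probability measure $\sigma$ on $\mathcal V$ such that $J_{\mathcal V,\|\cdot\|,\sigma}(D)<\infty$, where $D$ is the diameter of $\mathcal V$ with respect to $\|\cdot\|$, and $$\lim_{\delta\to0}J_{\mathcal V,\|\cdot\|,\sigma}(\delta)=0.$$ Then $\psi$ (i.e. a suitable version of it) is uniformly continuous on $(\mathcal V,\|\cdot\|)$ almost surely.
   Context: $S$ is a locally compact metric space with countable base; $\mathcal M(S)$ is the set of finite signed Radon measures on its Borel $\sigma$-algebra; $u$ is a kernel on $S\times S$ (not necessarily symmetric, possibly infinite on the diagonal). A map $\psi$ from $\mathcal V\subseteq\mathcal M(S)$ to random variables on a probability space is an $\alpha$-permanental field with kernel $u$ if $E\psi(\nu)=0$ for all $\nu\in\mathcal V$ and, for all integers $n\ge2$ and $\nu_1,\dots,\nu_n\in\mathcal V$, $$E\Bigl(\prod_{j=1}^n\psi(\nu_j)\Bigr)=\sum_{\pi\in\mathcal P'}\alpha^{c(\pi)}\int\prod_{j=1}^n u(x_j,x_{\pi(j)})\prod_{j=1}^n d\nu_j(x_j),$$ where $\mathcal P'$ is the set of permutations $\pi$ of $[1,n]$ with $\pi(j)\ne j$ for every $j$ and $c(\pi)$ is the number of cycles of $\pi$. A norm $\|\cdot\|$ on $\mathcal M(S)$ (the value $+\infty$ being allowed) is a proper norm with respect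 to $u$ if there is a constant $C<\infty$ such that for all $n\ge2$ and $\nu_1,\dots,\nu_n\in\mathcal M(S)$, with $x_{n+1}=x_1$, $$\Bigl|\int\prod_{j=1}^n u(x_j,x_{j+1})\prod_{i=1}^n d\nu_i(x_i)\Bigr|\le C^n\prod_{j=1}^n\|\nu_j\|.$$ $\mathcal M_{\|\cdot\|}$ is the set of differences $\nu_1-\nu_2$ of positive measures $\nu_1,\nu_2\in\mathcal M(S)$ with $\|\nu_1\|,\|\nu_2\|<\infty$. $(\mathcal V,\|\cdot\|)$ denotes $\mathcal V$ with the metric $\|\mu-\nu\|$; $B_{\|\cdot\|}(\nu,r)$ is the closed ball in $(\mathcal V,\|\cdot\|)$ with radius $r$ and center $\nu$. For a probability measure $\sigma$ on $(\mathcal V,\|\cdot\|)$, $$J_{\mathcal V,\|\cdot\|,\sigma}(a)=\sup_{\nu\in\mathcal V}\int_0^a\log\frac1{\sigma(B_{\|\cdot\|}(\nu,r))}\,dr.$$ *)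

(* Defs.v *)
From HB Require Import structures.
From mathcomp Require Import all_boot all_order all_algebra all_fingroup.
From mathcomp Require Import all_classical all_reals all_analysis.
From mathcomp Require Import measurable_realfun.

Set Implicit Arguments.
Unset Strict Implicit.
Unset Printing Implicit Defensive.

Import Order.TTheory GRing.Theory Num.Theory.
Import numFieldNormedType.Exports.

Local Open Scope classical_set_scope.
Local Open Scope ring_scope.

(* Measurable types are pointed in the library, hence so is the space. *)
#[short(type="pmetricType")]
HB.structure Definition PointedMetric (K : numDomainType) :=
  {M of Metric K M & Pointed M}.

Notation borel S := (g_sigma_algebraType (@open S)).

Definition signed_measure (R : realType) (S : pmetricType R) :=
  {charge set (borel S) -> \bar R}.

Section SignedMeasures.
Context (R : realType) (S : pmetricType R).
Local Open Scope ereal_scope.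

HB.instance Definition _ := gen_eqMixin (signed_measure S).
HB.instance Definition _ := gen_choiceMixin (signed_measure S).
HB.instance Definition _ := isPointed.Build (signed_measure S)
  (@czero _ (borel S) R : {charge set _ -> \bar R}).

Implicit Types nu mu : signed_measure S.

Definition csub mu nu : signed_measure S :=
  (cadd mu (cscale (-1) nu) : {charge set _ -> \bar R}).

(* By uniqueness of the Hahn decomposition up to null sets, the Jordan
   decomposition below does not depend on the choice that is made. *)
Definition hahn_pos_ex nu := cid (@Hahn_decomposition _ (borel S) R nu).
Definition hahn_neg_ex nu := cid (svalP (hahn_pos_ex nu)).
Definition hahn nu : hahn_decomposition nu
    (sval (hahn_pos_ex nu)) (sval (hahn_neg_ex nu)) :=
  svalP (hahn_neg_ex nu).

(* [jordan false nu] and [jordan true nu] are the positive and the negative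
   part of [nu]. *)
Definition jordan (neg : bool) nu : set (borel S) -> \bar R :=
  if neg then jordan_neg (hahn nu) else jordan_pos (hahn nu).

Definition variation nu : set (borel S) -> \bar R := charge_variation (hahn nu).

(* Charges are functions of all subsets of [S]; requiring the value 0 on the
   non-Borel ones makes equality of charges coincide with equality of signed
   measures on the Borel sigma-algebra. *)
Definition radon_measures : set (signed_measure S) := [set nu : signed_measure S |
  (forall A : set (borel S), ~ measurable A -> nu A = 0) /\
  (forall (A : set (borel S)) (e : R), measurable A -> (0 < e)%R ->
     exists K : set S,
       [/\ compact K, K `<=` A & variation nu (A `\` K) < e%:E])].

Fixpoint tuple_product (n : nat) :
    ('I_n -> set (borel S) -> \bar R) -> set (n.-tuple (borel S)) -> \bar R :=
  match n with
  | 0 => fun=> \d_([tuple] : 0.-tuple (borel S))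
  | m.+1 => fun ms =>
      pushforward (ms ord0 \x tuple_product (fun i => ms (lift ord0 i)))
        (fun p : borel S * m.-tuple (borel S) => [tuple of p.1 :: p.2])
  end.

Section SignedProduct.
Context (n : nat) (nu : 'I_n -> signed_measure S).
Implicit Types f : n.-tuple (borel S) -> \bar R.

(* Expanding each [nu i] as the difference of its Jordan parts, the product of
   the [nu i] is the sum, over all [s : 'I_n -> bool], of [jordan_product s]
   with the sign given by the parity of the number of negative parts. *)
Definition jordan_product (s : {ffun 'I_n -> bool}) :=
  tuple_product (fun i => jordan (s i) (nu i)).

Definition minus_sign (s : {ffun 'I_n -> bool}) := odd #|[set i | s i]%SET|.

Definition signed_integral_pos f : \bar R :=
  \sum_(s | ~~ minus_sign s) \int[jordan_product s]_x (f^\+ x) +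
  \sum_(s | minus_sign s) \int[jordan_product s]_x (f^\- x).

Definition signed_integral_neg f : \bar R :=
  \sum_(s | ~~ minus_sign s) \int[jordan_product s]_x (f^\- x) +
  \sum_(s | minus_sign s) \int[jordan_product s]_x (f^\+ x).

Definition signed_integral f : \bar R :=
  signed_integral_pos f - signed_integral_neg f.

(* The integral makes sense in [-oo, +oo], i.e. it is not of the form
   [+oo - oo]. *)
Definition signed_integral_exists f : bool :=
  signed_integral_pos f +? - signed_integral_neg f.

Definition signed_integrable f : Prop :=
  measurable_fun [set: n.-tuple (borel S)] f /\
  \int[tuple_product (fun i => variation (nu i))]_x `|f x| < +oo.

End SignedProduct.

Definition is_kernel (u : S -> S -> \bar R) : Prop :=
  measurable_fun setT (fun p : borel S * borel S => u p.1 p.2) /\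
  (forall x y, x <> y -> u x y \is a fin_num).

Definition perm_integrand (u : S -> S -> \bar R) (n : nat) (s : 'I_n -> 'I_n)
    (x : n.-tuple (borel S)) : \bar R :=
  \prod_(j < n) u (tnth x j) (tnth x (s j)).

Definition is_norm (N : signed_measure S -> \bar R) : Prop :=
  [/\ forall nu, radon_measures nu -> 0 <= N nu,
      forall nu, radon_measures nu -> N nu = 0 -> forall A, nu A = 0,
      forall (a : R) nu, radon_measures nu ->
        N (cscale a nu : {charge set _ -> \bar R}) = `|a|%:E * N nu &
      forall mu nu, radon_measures mu -> radon_measures nu ->
        N (cadd mu nu : {charge set _ -> \bar R}) <= N mu + N nu].

(* [ordS] is the cyclic successor on ['I_n]. The inequality is required
   whenever its left-hand side makes sense; for nonnegative [u] and [nu] this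
   is always the case, and the integral must be finite if the norms are. *)
Definition proper_norm (u : S -> S -> \bar R)
    (N : signed_measure S -> \bar R) : Prop :=
  is_norm N /\
  exists2 C : R, (0 <= C)%R &
    forall (n : nat) (nu : 'I_n -> signed_measure S), (2 <= n)%N ->
      (forall j, radon_measures (nu j)) ->
      signed_integral_exists nu (perm_integrand u (@ordS n)) ->
      `|signed_integral nu (perm_integrand u (@ordS n))|
        <= (C ^+ n)%:E * \prod_(j < n) N (nu j).

Definition finite_norm_measures (N : signed_measure S -> \bar R) :
    set (signed_measure S) := [set nu : signed_measure S |
  radon_measures nu /\
  exists nu1 nu2, [/\ radon_measures nu1 /\ radon_measures nu2,
    (forall A, 0 <= nu1 A) /\ (forall A, 0 <= nu2 A),
    N nu1 < +oo /\ N nu2 < +oo &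
    forall A, nu A = nu1 A - nu2 A]].

(* The condition of integrability says that the integrals on the right-hand
   side are absolutely convergent. Since ['E_P] is [\bar R]-valued, its
   being finite then entails the integrability of the product. *)
Definition permanental_field d (Omega : measurableType d)
    (P : probability Omega R) (alpha : R) (u : S -> S -> \bar R)
    (V : set (signed_measure S)) (psi : V -> {RV P >-> R}) : Prop :=
  [/\ V `<=` radon_measures,
      forall nu : V, 'E_P[psi nu] = 0 &
      forall (n : nat) (nu : 'I_n -> V), (2 <= n)%N ->
        (forall s : {perm 'I_n}, (forall j, s j != j) ->
           signed_integrable (fun j => val (nu j)) (perm_integrand u s)) /\
        'E_P[fun w => (\prod_(j < n) psi (nu j) w)%R] =
        \sum_(s : {perm 'I_n} | [forall j, s j != j])
          (alpha ^+ #|porbits s|)%:E *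
          signed_integral (fun j => val (nu j)) (perm_integrand u s)].

Section MetricEntropy.
Context (N : signed_measure S -> \bar R) (V : set (signed_measure S)).

Definition norm_dist mu nu : \bar R := N (csub mu nu).

Definition norm_ball nu (r : R) : set (signed_measure S) :=
  [set mu | V mu /\ norm_dist mu nu <= r%:E].

(* The sets whose trace on [V] is open in [(V, N)]. The sigma-algebra they
   generate on [signed_measure S] consists of the sets whose trace on [V] is
   Borel in [(V, N)]: its probability measures that charge only [V] are the
   Borel probability measures on [(V, N)]. *)
Definition norm_open : set (set (signed_measure S)) :=
  [set A | forall nu, V nu -> A nu ->
    exists2 r : R, (0 < r)%R &
      forall mu, V mu -> norm_dist mu nu < r%:E -> A mu].

Definition norm_borel := g_sigma_algebraType norm_open.

Definition norm_diameter : \bar R :=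
  ereal_sup [set norm_dist p.1 p.2 | p in V `*` V].

Definition entropy_integral (sigma : probability norm_borel R) (a : \bar R) :
    \bar R :=
  ereal_sup [set \int[lebesgue_measure]_(r in [set r : R | (0 <= r)%R /\
                                                         r%:E <= a])
                   lne ((sigma (norm_ball nu r))^-1) | nu in V].

End MetricEntropy.

Definition version d (Omega : measurableType d) (P : probability Omega R)
    (V : set (signed_measure S)) (psi' psi : V -> {RV P >-> R}) : Prop :=
  forall nu : V, {ae P, forall w, psi' nu w = psi nu w}.

Definition uniformly_continuous_on (N : signed_measure S -> \bar R)
    (V : set (signed_measure S)) (f : V -> R) : Prop :=
  forall e : R, (0 < e)%R -> exists2 delta : R, (0 < delta)%R &
    forall mu nu : V, norm_dist N (val mu) (val nu) < delta%:E ->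
      (`|f mu - f nu| < e)%R.

End SignedMeasures.

(* Main.v *)
(* Let f = psi mu - psi nu and lambda = mu - nu. Expanding by multilinearity,
   E f^n is the sum, over the permutations s of [1, n] without fixed point, of
   alpha^c(s) times the integral of prod_j u(x_j, x_(s j)) against lambda^n.
   Each of these integrals is the product, over the cycles of s, of integrals
   along a cyclic permutation, hence is at most (C ||lambda||)^n by properness
   of the norm. Thus |E f^n| <= n! (K ||lambda||)^n for a constant K, whence
   E exp(|f| / (L ||lambda||)) <= 4 for a larger constant L.

   The continuity then follows by chaining. Put r_k = r_0 / 2^k and let W_k(x)
   be the sigma-measure of the ball of center x and radius r_k. A greedy choice
   gives, for each k, a net T_k whose balls of radius r_k are disjoint, so that
   the sum of W_k over T_k is at most 1, and such that any x is within 2 r_k of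
   a point t = pi_k(x) of T_k with W_k(x) <= 2 W_k(t). The sum, over k and over
   the pairs (s, t) of points of T_k or T_(k+1) at distance at most 5 r_k, of
   2^-k W(s) W(t) exp(|psi s - psi t| / (5 L r_k)) has finite expectation.
   Almost surely it is finite, hence |psi s - psi t| is at most
   5 L r_k (Z + k log 2 + log 1/W(s) + log 1/W(t)) for all these pairs at once.
   These bounds are summable along x |-> (pi_k(x))_k, uniformly in x, because
   sum_(k >= K) r_k log 1/W_k(x) <= 2 J(r_K), which goes to 0. *)
Require Import Defs.
From HB Require Import structures.
From mathcomp Require Import all_boot all_order all_algebra all_fingroup.
From mathcomp Require Import all_classical all_reals all_analysis.
From mathcomp Require Import measurable_realfun zify ring lra.

Set Implicit Arguments.
Unset Strict Implicit.
Unset Printing Implicit Defensive.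

Import Order.TTheory GRing.Theory Num.Theory.
Import numFieldNormedType.Exports.

Local Open Scope classical_set_scope.
Local Open Scope ring_scope.

(** * Chaining *)

(** A maximum need not be attained, but the supremum of [W] over [U] is positive and finite, so some
    point of [U] exceeds half of it. *)
Lemma near_max (R : realType) (T : Type) (U : set T) (W : T -> R) :
  U !=set0 -> (forall x, U x -> 0 < W x <= 1) ->
  exists2 t, U t & forall x, U x -> W x <= 2 * W t.
Proof.
move=> [x0 Ux0] W01.
have supW : has_sup (W @` U).
  by split; [exists (W x0), x0|exists 1 => _ [x Ux <-]; case/andP: (W01 _ Ux)].
have sup0 : 0 < sup (W @` U).
  have /andP[Wx0 _] := W01 _ Ux0.
  by apply: (lt_le_trans Wx0); apply: ub_le_sup; [case: supW|exists x0].
have [_ [t Ut <-] tP] := @sup_adherent _ _ (sup (W @` U) / 2) (divr_gt0 sup0 (ltr0n _ 2)) supW.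
exists t => // x Ux.
have : W x <= sup (W @` U) by apply: ub_le_sup; [case: supW|exists x].
by lra.
Qed.

(** Induction on the maximal size of a separated sequence in [U]: take a nearly maximal point [t],
    then recurse on the points of [U] farther than [r] from [t]. Their separated sequences can be
    extended by [t], so the bound drops by one. A point dropped at this stage is covered by [t],
    whose weight is at least half of its own. *)
Lemma greedy_net (R : realType) (T : choiceType) (rho : T -> T -> \bar R)
  (W : T -> R) (r : \bar R) (n : nat) (U : set T) :
  (forall x, 0 < W x <= 1) ->
  (forall s : seq T, (forall x, x \in s -> U x) ->
     pairwise (fun x y => r < rho x y)%E s -> (size s <= n)%N) ->
  exists s : seq T, [/\ forall x, x \in s -> U x,
    pairwise (fun x y => r < rho x y)%E s &
    forall x, U x -> exists t, [/\ t \in s, (rho t x <= r)%E & W x <= 2 * W t]].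
Proof.
move=> W01; elim: n U => [|n IH] U Un.
  exists [::]; split => // x Ux.
  have := Un [:: x]; rewrite /= => H; exfalso.
  by suff: (1 <= 0)%N by []; apply: H => // y; rewrite inE => /eqP ->.
have [U0|/nonemptyPn ->] := pselect (U !=set0); last by exists [::]; split.
have [t Ut tmax] := near_max U0 (fun x _ => W01 x).
have [|s [sU sp scov]] := IH (U `&` [set x | r < rho t x]%E).
  move=> s sU sp.
  suff : (size (t :: s) <= n.+1)%N by [].
  apply: Un => [x|]; first by rewrite inE => /orP[/eqP->//|/sU[]].
  by rewrite /= sp andbT; apply/allP => x /sU[].
exists (t :: s); split => [x||x Ux].
- by rewrite inE => /orP[/eqP->//|/sU[]].
- by rewrite /= sp andbT; apply/allP => x /sU[].
- have [rx|rx] := leP (rho t x) r.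
    by exists t; rewrite mem_head rx tmax.
  have [//|t' [t's t'r t'W]] := scov x.
  by exists t'; rewrite inE t's orbT.
Qed.

(** The sum of 2^-(n+1) h_n has integral at most [b], hence is finite almost everywhere, and it
    dominates each of its terms. *)
Lemma ae_geometric_bound (R : realType) d (Omega : measurableType d)
    (P : {measure set Omega -> \bar R}) (h : nat -> Omega -> \bar R) (b : R) :
  (forall n, measurable_fun setT (h n)) -> (forall n w, 0 <= h n w)%E ->
  (forall n, \int[P]_w h n w <= b%:E)%E ->
  {ae P, forall w, exists2 z : R, 0 < z & forall n, (h n w <= (z * 2 ^+ n)%:E)%E}.
Proof.
move=> mh h0 hb.
have b0 : 0 <= b.
  by rewrite -lee_fin (le_trans _ (hb 0%N))//; exact: integral_ge0.
pose g n w := ((2 ^- n.+1)%:E * h n w)%E.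
have g0 n w : (0 <= g n w)%E by rewrite mule_ge0// lee_fin invr_ge0 exprn_ge0.
have mg n : measurable_fun setT (g n) by exact: measurable_funeM.
have gfin : P.-integrable setT (fun w => \sum_(n <oo) g n w)%E.
  apply/integrableP; split; first exact: ge0_emeasurable_sum.
  under eq_integral do rewrite gee0_abs ?nneseries_ge0//.
  rewrite integral_nneseries//.
  have Hle : (\sum_(n <oo) \int[P]_w g n w <= \sum_(n <oo) ((b / (2 ^ n.+1)%:R)%:E))%E.
    apply: lee_nneseries => [n _ _|n _]; first exact: integral_ge0.
    rewrite ge0_integralZl_EFin//.
    rewrite mulrC EFinM natrX; by apply: lee_pmul => //; exact: integral_ge0.
  apply: (le_lt_trans Hle).
  have := @epsilon_trick R (fun=> 0%E) b xpredT (fun=> lexx _) b0.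
  under eq_eseriesr do rewrite add0e.
  by move=> /le_lt_trans; apply; rewrite eseries0// add0e ltry.
have := integrable_ae measurableT gfin; apply: filterS => w /(_ I).
set s := (\sum_(n <oo) g n w)%E => sfin.
have s0 : (0 <= s)%E by exact: nneseries_ge0.
(* Adding 1 keeps the constant positive even if the sum is 0, so that its logarithm can be taken. *)
exists (2 * (fine s + 1)); first by rewrite mulr_gt0// ltr_wpDl// fine_ge0.
move=> n; have gs : (g n w <= s)%E.
  apply: le_trans (nneseries_lim_ge n.+1 _); last by [].
  by rewrite big_nat_recr//= leeDr// sume_ge0.
have /fineK sE := sfin.
have : ((2 ^+ n.+1)%:E * g n w <= (2 ^+ n.+1)%:E * s)%E.
  by apply: lee_pmul => //; rewrite lee_fin exprn_ge0.
rewrite /g muleA -EFinM divff ?expf_neq0// mul1e => /le_trans; apply.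
rewrite -sE -EFinM lee_fin mulrC exprS mulrA [leRHS]mulrAC.
by have : 0 <= 2 ^+ n :> R by []; rewrite /=; lra.
Qed.

(** All increments beyond [K] add up to at most [eta K], so the sequence is Cauchy and the bound
    passes to the limit. *)
Lemma telescope_cvg_bound (R : realType) (x a eta : nat -> R) :
  (forall k, `|x k.+1 - x k| <= a k) ->
  (forall K M, \sum_(K <= k < M) a k <= eta K) ->
  eta @ \oo --> 0 ->
  cvgn x /\ forall K, `|limn x - x K| <= eta K.
Proof.
move=> xa aeta eta0.
have xKM K M : (K <= M)%N -> `|x M - x K| <= eta K.
  move=> KM; rewrite -(telescope_sumr _ KM) (le_trans (ler_norm_sum _ _ _))//.
  by rewrite (le_trans _ (aeta K M))//; exact: ler_sum.
have cx : cvgn x.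
  apply/cauchy_cvgP; apply: cauchy_exP => e e0.
  have /cvgrPdist_lt/(_ _ e0)[K _ KP] := eta0.
  exists (x K); exists K => // m /= Km.
  rewrite /ball/= distrC (le_lt_trans (xKM _ _ Km))//.
  by rewrite (le_lt_trans (ler_norm _))// -normrN -sub0r KP/=.
split => // K.
have : `|x n - x K| @[n --> \oo] --> `|limn x - x K|.
  by apply: cvg_norm; apply: cvgB => //; exact: cvg_cst.
move=> /(@cvg_lim _ (@Rhausdorff R)) <-; apply: limr_le.
  by apply: is_cvg_norm; apply: is_cvgB => //; exact: is_cvg_cst.
by exists K => // n /=; exact: xKM.
Qed.

(** Multiplied by 2^-k, this bounds the terms (k + 2) / 2^k of the chaining by a geometric sequence
    of ratio 3/4. *)
Lemma ler_expn_linear (R : realType) (k : nat) : (k.+2)%:R <= 2 * (3 / 2) ^+ k :> R.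
Proof.
elim: k => [|k IH]; first by rewrite expr0 mulr1.
have k0 : 0 <= k%:R :> R by exact: ler0n.
by rewrite exprS -natr1; move: IH; rewrite -[k.+2%:R]natr1 -[k.+1%:R]natr1; lra.
Qed.

Lemma mfun_of (R : realType) d (Omega : measurableType d) (f : Omega -> R) :
  measurable_fun setT f -> exists g : {mfun Omega >-> R}, forall w, g w = f w.
Proof.
move=> mf.
pose g : {mfun Omega >-> R} := HB.pack f (isMeasurableFun.Build _ _ _ _ f mf).
by exists g.
Qed.

(** * Construction of a uniformly continuous version along nets *)

Section Chaining.
Context (R : realType) (d : measure_display) (Omega : measurableType d)
  (P : probability Omega R) (T : choiceType) (rho : T -> T -> \bar R)
  (W : nat -> T -> R) (X : T -> {RV P >-> R}) (L r0 : R) (e : nat -> R).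
Let r k := r0 / 2 ^+ k.
Hypotheses (L0 : 0 < L) (r00 : 0 < r0).
Hypotheses (rho_sym : forall x y, rho x y = rho y x)
  (rho_tri : forall y x z, (rho x z <= rho x y + rho y z)%E).
(** The weights stand for measures of balls. [W_sep] reflects the disjointness of balls with distant
    centers and, together with [W_low], bounds the size of separated sequences; [W_ent] is the
    entropy condition, with tails bounded by [e]. *)
Hypotheses (W01 : forall k x, 0 < W k x <= 1)
  (W_low : forall k, exists2 c, 0 < c & forall x, c <= W k x)
  (W_sep : forall k s, pairwise (fun x y => (2 * r k)%:E < rho x y)%E s ->
     \sum_(x <- s) W k x <= 1)
  (W_ent : forall x K M, \sum_(K <= k < M) r k * - ln (W k x) <= e K)
  (e0 : e @ \oo --> 0).
Hypothesis X_exp : forall x y (q : R), 0 < q -> (rho x y <= q%:E)%E ->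
  (\int[P]_w (expR (`|X x w - X y w| / (L * q)))%:E <= 4%:E)%E.

Let r_gt0 k : 0 < r k.
Proof. by rewrite divr_gt0// exprn_gt0. Qed.

Let rS k : r k = 2 * r k.+1.
Proof. by rewrite /r exprS; field; rewrite expf_neq0. Qed.

(** A separated sequence has total weight at most 1 and each term weighs at least [c], so it has at
    most 1/c terms; hence the greedy construction stops. *)
Lemma chaining_nets : exists (S : nat -> seq T) (pi : nat -> T -> T), forall k,
  \sum_(x <- S k) W k x <= 1 /\ forall x,
  [/\ pi k x \in S k, (rho (pi k x) x <= (2 * r k)%:E)%E & W k x <= 2 * W k (pi k x)].
Proof.
have net k : exists s : seq T, \sum_(x <- s) W k x <= 1 /\ forall x,
    exists t, [/\ t \in s, (rho t x <= (2 * r k)%:E)%E & W k x <= 2 * W k t].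
  have [c c0 cW] := W_low k.
  have [|s [_ ssep sP]] := @greedy_net R T rho (W k) (2 * r k)%:E
      (Num.truncn c^-1) setT (W01 k).
    move=> s _ ssep; rewrite truncn_ge_nat ?invr_ge0 ?(ltW c0)// -[X in _ <= X]mul1r ler_pdivlMr//.
    apply: le_trans (W_sep ssep).
    by rewrite mulr_natl -sum1_size -sumrMnr; apply: ler_sum => x _; exact: cW.
  by exists s; split; [exact: W_sep|move=> x; exact: sP].
have [S SP] := choice net.
have /choice[pi piP] : forall k, exists p : T -> T, forall x,
    [/\ p x \in S k, (rho (p x) x <= (2 * r k)%:E)%E & W k x <= 2 * W k (p x)].
  by move=> k; have [p pP] := choice (proj2 (SP k)); exists p.
by exists S, pi => k; split; [case: (SP k)|exact: piP].
Qed.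

(** For each [k], the exponentials of the normalized increments, weighted by the product of the
    weights of the two points, have a sum of bounded expectation. Almost surely these sums grow at
    most like 2^k; the logarithm of a single term then gives the bound. *)
Lemma chaining_increments (S : nat -> seq T) :
  (forall k, \sum_(x <- S k) W k x <= 1) ->
  {ae P, forall w, exists c : R, forall k m n x y,
    m \in [:: k; k.+1] -> n \in [:: k; k.+1] -> x \in S m -> y \in S n ->
    (rho x y <= (5 * r k)%:E)%E ->
    `|X x w - X y w| <=
      5 * L * r k * (c + k%:R * ln 2 - ln (W m x) - ln (W n y))}.
Proof.
move=> S1.
(* Each point carries its weight, since a point common to the nets of levels [k] and [k.+1] has a
   weight for each level. *)
pose U k := [seq (x, W k x) | x <- S k] ++ [seq (x, W k.+1 x) | x <- S k.+1].
have U2 k : \sum_(p <- U k) p.2 <= 2.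
  by rewrite big_cat !big_map/=; have := S1 k; have := S1 k.+1; lra.
have U0 k p : p \in U k -> 0 < p.2.
  rewrite mem_cat => /orP[] /mapP[x _ ->] /=; [case/andP: (W01 k x)|case/andP: (W01 k.+1 x)] => //.
pose pairs k := [seq pq <- [seq (p, q) | p <- U k, q <- U k] |
  (rho pq.1.1 pq.2.1 <= (5 * r k)%:E)%E].
(* The absolute value makes [f] nonnegative for all pairs, including those outside [pairs k]. *)
pose f k (pq : (T * R) * (T * R)) w : \bar R := (`|pq.1.2 * pq.2.2|%:E *
  (expR (`|X pq.1.1 w - X pq.2.1 w| / (L * (5 * r k))))%:E)%E.
have mX x y q : measurable_fun setT (fun w => (expR (`|X x w - X y w| / q))%:E).
  apply/measurable_EFinP; apply: measurableT_comp => //.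
  by apply: measurable_funM => //; apply: measurableT_comp => //; exact: measurable_funB.
pose h k w := (\sum_(pq <- pairs k) f k pq w)%E.
have f0 k pq w : (0 <= f k pq w)%E by rewrite /f mule_ge0// lee_fin expR_ge0.
have mf k pq : measurable_fun setT (f k pq) by exact: measurable_funeM.
have h0 k w : (0 <= h k w)%E by exact: sume_ge0.
have mh k : measurable_fun setT (h k) by exact: emeasurable_sum.
have r5 k : 0 < 5 * r k by rewrite mulr_gt0.
(* 16 = 2 * 2 * 4: the weights in [U k] add up to at most 2, and each exponential moment is at most
   4. *)
have h16 k : (\int[P]_w h k w <= 16%:E)%E.
  rewrite /h ge0_integral_sum//.
  apply: (@le_trans _ _ (\sum_(pq <- pairs k) (pq.1.2 * pq.2.2 * 4)%:E)%E).
    rewrite big_seq [leRHS]big_seq; apply: lee_sum => pq.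
    rewrite mem_filter => /andP[rpq /allpairsP[[p q] [/= /U0 p0 /U0 q0 pqE]]].
    have pq0 : 0 < pq.1.2 * pq.2.2 by rewrite pqE/= mulr_gt0.
    rewrite /f ge0_integralZl_EFin//.
    by rewrite gtr0_norm// [leRHS]EFinM lee_pmul2l ?X_exp// lte_fin.
  rewrite sumEFin lee_fin big_filter big_mkcond/=.
  apply: (@le_trans _ _ (\sum_(pq <- [seq (p, q) | p <- U k, q <- U k]) pq.1.2 * pq.2.2 * 4)).
    rewrite big_seq [leRHS]big_seq; apply: ler_sum => pq.
    move=> /allpairsP[[p q] [/= /U0 p0 /U0 q0 ->]]; case: ifP => //= _.
    by rewrite !mulr_ge0// ltW.
  rewrite -mulr_suml big_allpairs/=.
  under eq_bigr do rewrite -mulr_sumr.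
  rewrite -mulr_suml.
  have := U2 k; have : 0 <= \sum_(p <- U k) p.2.
    by rewrite big_seq; apply: sumr_ge0 => p /U0/ltW.
  by move: (\sum_(p <- U k) p.2) => x; nra.
have := ae_geometric_bound mh h0 h16; apply: filterS => w [z z0 zP].
exists (ln z) => k m n x y mk nk xS yS rxy.
have inU m' x' : m' \in [:: k; k.+1] -> x' \in S m' -> (x', W m' x') \in U k.
  rewrite !inE mem_cat => /orP[]/eqP-> xS'; apply/orP; [left|right]; exact: map_f.
have xypairs : ((x, W m x), (y, W n y)) \in pairs k.
  by rewrite mem_filter/= rxy/=; apply: allpairs_f; exact: inU.
have : (f k ((x, W m x), (y, W n y)) w <= (z * 2 ^+ k)%:E)%E.
  by apply: le_trans (zP k); rewrite /h (big_rem _ xypairs)/= leeDl// sume_ge0.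
have /andP[Wx _] := W01 m x; have /andP[Wy _] := W01 n y.
rewrite /f/= -EFinM lee_fin gtr0_norm ?mulr_gt0//.
rewrite -ler_ln ?posrE ?mulr_gt0 ?expR_gt0 ?exprn_gt0//.
rewrite !lnM ?posrE ?mulr_gt0 ?expR_gt0 ?exprn_gt0//.
rewrite expRK lnXn// -[ln 2 *+ k]mulr_natl => H.
have Lr : 0 < L * (5 * r k) by rewrite mulr_gt0.
rewrite [leRHS](_ : _ = (ln z + k%:R * ln 2 - ln (W m x) - ln (W n y)) *
  (L * (5 * r k))); last by ring.
by rewrite -ler_pdivrMr//; lra.
Qed.

(** The factor 8 makes [shrink k - shrink k.+1] equal to 2 (3/4)^k, so that the terms r_k (k + 2)
    are bounded by telescoping differences. *)
Let shrink k := 8 * (3 / 4) ^+ k : R.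

Let r_linear k : r k * k.+2%:R <= r0 * (shrink k - shrink k.+1).
Proof.
rewrite /r/shrink -mulrA ler_pM2l//.
have /(ler_wpM2l (_ : 0 <= (2 ^+ k)^-1)) := ler_expn_linear R k.
move=> /(_ _)/le_trans; apply; first by rewrite invr_ge0 exprn_ge0.
rewrite (_ : 3 / 2 = (3 / 4) * 2)//; last by field.
rewrite exprMn exprS mulrCA [_^-1 * _]mulrC -!mulrA divff ?expf_neq0// mulr1.
by lra.
Qed.

Let shrink0 : shrink @ \oo --> 0.
Proof.
rewrite -(mulr0 8); apply: cvgMr; apply: cvg_expr.
by rewrite ger0_norm//; lra.
Qed.

Let r_cvg0 : r @ \oo --> 0.
Proof.
rewrite -(mulr0 r0); apply: cvgMr.
under eq_fun do rewrite -exprVn.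
by apply: cvg_expr; rewrite ger0_norm//; lra.
Qed.

(** For a fixed [x] there is one increment per level, and no weights enter: almost surely it is at
    most 2 L r_k (log z + k log 2), which tends to 0. *)
Lemma chaining_approx (pi : nat -> T -> T) :
  (forall k x, (rho (pi k x) x <= (2 * r k)%:E)%E) ->
  forall x, {ae P, forall w, X (pi k x) w @[k --> \oo] --> X x w}.
Proof.
move=> pir x.
pose h k w : \bar R := (expR (`|X (pi k x) w - X x w| / (L * (2 * r k))))%:E.
have mh k : measurable_fun setT (h k).
  apply/measurable_EFinP; apply: measurableT_comp => //.
  by apply: measurable_funM => //; apply: measurableT_comp => //; exact: measurable_funB.
have h4 k : (\int[P]_w h k w <= 4%:E)%E by apply: X_exp => //; rewrite mulr_gt0.
have h0 k w : (0 <= h k w)%E by rewrite lee_fin expR_ge0.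
have := ae_geometric_bound mh h0 h4; apply: filterS => w [z z0 zP].
pose b k := 2 * L * (r k * `|ln z| + ln 2 * r0 * shrink k).
have b0 : b @ \oo --> 0.
  rewrite -(mulr0 (2 * L)); apply: cvgMr; rewrite -(addr0 0).
  apply: cvgD; first by rewrite -(mul0r `|ln z|); exact: cvgMl.
  by rewrite -(mulr0 (ln 2 * r0)); exact: cvgMr.
apply/cvgrPdist_le => eps eps0; have /cvgrPdist_le/(_ _ eps0) := b0.
apply: filterS => k /=; rewrite sub0r normrN => /(le_trans (ler_norm _)); apply: le_trans.
have := zP k; rewrite lee_fin -ler_ln ?posrE ?expR_gt0 ?mulr_gt0 ?exprn_gt0//.
rewrite expRK lnM ?posrE ?exprn_gt0// lnXn// -(mulr_natl (ln 2) k).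
rewrite ler_pdivrMr ?mulr_gt0// distrC => /le_trans; apply.
rewrite /b [leLHS](_ : _ = 2 * L * (r k * ln z + ln 2 * (r k * k%:R))); last by ring.
rewrite ler_pM2l ?mulr_gt0// -(mulrA (ln 2)) lerD//.
  by rewrite ler_pM2l// ler_norm.
rewrite ler_wpM2l ?ln_ge0 ?ler1n//.
apply: (@le_trans _ _ (r k * k.+2%:R)); first by rewrite ler_wpM2l ?ltW// ltr_nat.
apply: (le_trans (r_linear k)); rewrite ler_pM2l// gerBl.
by rewrite mulr_ge0// exprn_ge0.
Qed.

(** The new version is the limit of [X (pi k x)]. On the single almost sure event of
    [chaining_increments] these limits exist for all [x] at once, with a uniform rate;
    [chaining_approx] identifies each limit with [X x] outside a null set that depends on [x]. *)
Theorem chaining : exists X' : T -> {RV P >-> R},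
  (forall x, {ae P, forall w, X' x w = X x w}) /\
  {ae P, forall w, forall eps : R, 0 < eps -> exists2 delta : R, 0 < delta &
    forall x y, (rho x y < delta%:E)%E -> `|X' x w - X' y w| < eps}.
Proof.
have [S [pi Spi]] := chaining_nets.
have S1 k : \sum_(x <- S k) W k x <= 1 by case: (Spi k).
have piS k x : pi k x \in S k by case: (Spi k) => _ /(_ x)[].
have pir k x : (rho (pi k x) x <= (2 * r k)%:E)%E by case: (Spi k) => _ /(_ x)[].
have piW k x : - ln (W k (pi k x)) <= ln 2 - ln (W k x).
  have [_ /(_ x)[_ _]] := Spi k.
  have /andP[Wx _] := W01 k x; have /andP[Wpx _] := W01 k (pi k x).
  by rewrite -ler_ln ?posrE ?mulr_gt0// lnM ?posrE//; lra.
(* The upper limit is measurable in [w] without any convergence, [fine] sends infinite values to 0,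
   and the value is the limit wherever it exists. *)
pose Y x w := fine (limn_esup (fun k => (X (pi k x) w)%:E)).
have mY x : measurable_fun setT (Y x).
  apply: measurableT_comp => //; apply: measurable_fun_limn_esup => k.
  exact/measurable_EFinP.
have YE x w (l : R) : X (pi k x) w @[k --> \oo] --> l -> Y x w = l.
  move=> Xl; rewrite /Y limn_esup_lim.
  have /cvg_esups/cvg_lim -> // : ((X (pi k x) w)%:E @[k --> \oo] --> l%:E)%E.
  by apply: cvg_EFin => //; exact: nearW.
have [X' X'E] := choice (fun x => mfun_of (mY x)).
exists X'; split => [x|].
  have := chaining_approx pir x; apply: filterS => w /YE.
  by rewrite X'E.
have := chaining_increments S1; apply: filterS => w [c cP].
have ln2_0 : 0 <= ln 2 :> R by rewrite ln_ge0// ler1n.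
(* The differences of [f] dominate r_k (c + (k + 2) log 2), where k log 2 comes from the bound on
   the increments and 2 log 2 from the factors 2 lost in the weights of the two net points. *)
pose f k := 2 * r k * `|c| + ln 2 * (r0 * shrink k).
(* Bound on a chain from level [K] on: [f] telescopes, the weights at level k contribute [e K], and
   those at level k + 1 come with the factor r_k = 2 r_(k+1), hence contribute [2 * e K.+1]. *)
pose eta K := 5 * L * (f K + e K + 2 * e K.+1).
have eta0 : eta @ \oo --> 0.
  rewrite -(mulr0 (5 * L)); apply: cvgMr.
  rewrite (_ : 0 = (2 * 0 * `|c| + ln 2 * (r0 * 0)) + 0 + 2 * 0); last by ring.
  apply: cvgD; last by apply: cvgMr; rewrite cvg_shiftS.
  apply: cvgD => //; apply: cvgD.
    by apply: cvgMl; exact: cvgMr.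
  by apply: cvgMr; exact: cvgMr.
pose a x k := 5 * L * (f k - f k.+1 + r k * - ln (W k x) + 2 * (r k.+1 * - ln (W k.+1 x))).
have fS k : r k * c + ln 2 * (r k * k.+2%:R) <= f k - f k.+1.
  rewrite (_ : f k - f k.+1 = r k * `|c| + ln 2 * (r0 * (shrink k - shrink k.+1))).
    by apply: lerD; [rewrite ler_pM2l// ler_norm|exact: ler_wpM2l].
  by rewrite /f [r k]rS; ring.
have shrink_ge0 k : 0 <= shrink k by rewrite mulr_ge0// exprn_ge0.
have f_ge0 k : 0 <= f k.
  by rewrite addr_ge0// mulr_ge0// ?mulr_ge0// ltW.
have e_ge0 (x : T) k : 0 <= e k by have := W_ent x k k; rewrite big_geq.
have XS K m n x y : m \in [:: K; K.+1] -> n \in [:: K; K.+1] ->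
    (rho (pi m x) (pi n y) <= (5 * r K)%:E)%E ->
    `|X (pi m x) w - X (pi n y) w| <= 5 * L *
       (f K - f K.+1 + r K * - ln (W m x) + r K * - ln (W n y)).
  move=> mK nK rK; apply: (le_trans (cP _ _ _ _ _ mK nK (piS _ _) (piS _ _) rK)).
  rewrite -[5 * L * r K * _]mulrA ler_pM2l ?mulr_gt0//.
  apply: (@le_trans _ _ (r K * (c + K%:R * ln 2 + (ln 2 - ln (W m x)) + (ln 2 - ln (W n y))))).
    by rewrite ler_pM2l// lerD// lerD.
  have := fS K; rewrite -[K.+2%:R]natr1 -[K.+1%:R]natr1.
  by lra.
have Xa x k : `|X (pi k.+1 x) w - X (pi k x) w| <= a x k.
  have rpi : (rho (pi k.+1 x) (pi k x) <= (5 * r k)%:E)%E.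
    apply: (le_trans (rho_tri x _ _)).
    rewrite (_ : (5 * r k)%:E = ((2 * r k.+1)%:E + (4 * r k)%:E))%E; last first.
      by rewrite -EFinD [r k]rS; congr EFin; ring.
    rewrite leeD// rho_sym (le_trans (pir _ _))// lee_fin.
    by have := r_gt0 k; lra.
  have := XS k k.+1 k x x; rewrite !inE !eqxx orbT => /(_ isT isT rpi)/le_trans; apply.
  rewrite /a ler_pM2l ?mulr_gt0// le_eqVlt; apply/orP; left; apply/eqP.
  by rewrite [r k]rS; ring.
have aeta x K M : \sum_(K <= k < M) a x k <= eta K.
  rewrite -mulr_sumr ler_pM2l ?mulr_gt0// big_split big_split/=.
  apply: lerD; [apply: lerD => //|].
    have [KM|/ltnW MK] := leqP K M; last by rewrite big_geq.
    rewrite -[leLHS]opprK -sumrN (eq_bigr (fun k => f k.+1 - f k)); last by move=> k _; ring.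
    by rewrite telescope_sumr//; have := f_ge0 M; lra.
  rewrite -mulr_sumr ler_pM2l//.
  by have := W_ent x K.+1 M.+1; rewrite big_add1.
have Yeta x K : `|Y x w - X (pi K x) w| <= eta K.
  have [cX /(_ K)] := telescope_cvg_bound (Xa x) (aeta x) eta0.
  by rewrite (YE _ _ _ cX).
move=> eps eps0.
(* The oscillation splits into two chains, from [x] and [y] to their net points at level [K],
   bounded by [eta K], and one step between these net points, bounded by [zeta K]. *)
pose zeta K := 5 * L * (f K + e K + e K).
have : (eta K + zeta K + eta K) @[K --> \oo] --> 0.
  rewrite -(addr0 0); apply: cvgD => //; rewrite -(addr0 0); apply: cvgD => //.
  rewrite -(mulr0 (5 * L)); apply: cvgMr.
  rewrite (_ : 0 = (2 * 0 * `|c| + ln 2 * (r0 * 0)) + 0 + 0); last by ring.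
  apply: cvgD => //; apply: cvgD => //; apply: cvgD.
    by apply: cvgMl; exact: cvgMr.
  by apply: cvgMr; exact: cvgMr.
move=> /cvgrPdist_lt/(_ _ eps0)[K _ /(_ K (leqnn K))].
rewrite sub0r normrN => /(le_lt_trans (ler_norm _)) Keps.
exists (r K) => // x y xy.
have rpi : (rho (pi K x) (pi K y) <= (5 * r K)%:E)%E.
  apply: (le_trans (rho_tri x _ _)).
  rewrite (_ : (5 * r K)%:E = ((2 * r K)%:E + (r K + 2 * r K)%:E))%E; last first.
    by rewrite -EFinD; congr EFin; ring.
  rewrite leeD// EFinD (le_trans (rho_tri y _ _))// leeD//; first exact: ltW.
  by rewrite rho_sym.
have := XS K K K x y; rewrite !inE !eqxx => /(_ isT isT rpi) XK.
have XZ : `|X (pi K x) w - X (pi K y) w| <= zeta K.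
  apply: (le_trans XK); rewrite ler_pM2l ?mulr_gt0//.
  apply: lerD; [apply: lerD|].
  - by have := f_ge0 K.+1; lra.
  - by have := W_ent x K K.+1; rewrite big_nat1.
  - by have := W_ent y K K.+1; rewrite big_nat1.
have := Yeta x K; have := Yeta y K; rewrite !X'E.
rewrite (_ : Y x w - Y y w = (Y x w - X (pi K x) w) +
  (X (pi K x) w - X (pi K y) w) - (Y y w - X (pi K y) w)); last by ring.
move=> Hy Hx; apply: le_lt_trans Keps.
by rewrite (le_trans (ler_normB _ _))// lerD// (le_trans (ler_normD _ _))// lerD.
Qed.

End Chaining.

(** * Integrals of products of kernels along permutations *)

Section BoundedMeasurable.
Context (R : realType).

Definition bmfun d (X : measurableType d) (f : X -> R) :=
  measurable_fun setT f /\ exists M, forall x, `|f x| <= M.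

Lemma bmfun_comp d d' (X : measurableType d) (Y : measurableType d')
    (g : X -> Y) (f : Y -> R) :
  measurable_fun setT g -> bmfun f -> bmfun (f \o g).
Proof.
move=> mg [mf [M fM]]; split; first exact: measurableT_comp.
by exists M => x; exact: fM.
Qed.

Lemma bmfunM d (X : measurableType d) (f g : X -> R) :
  bmfun f -> bmfun g -> bmfun (fun x => f x * g x).
Proof.
move=> [mf [M fM]] [mg [N gN]]; split; first exact: measurable_funM.
by exists (M * N) => x; rewrite normrM ler_pM.
Qed.

Lemma bmfun_prod d (X : measurableType d) (I : Type) (s : seq I) (P : pred I) (f : I -> X -> R) :
  (forall i, bmfun (f i)) -> bmfun (fun x => \prod_(i <- s | P i) f i x).
Proof.
move=> bf; elim: s => [|i s IH].
  by under eq_fun do rewrite big_nil; split => //; exists 1 => x; rewrite normr1.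
under eq_fun do rewrite big_cons; case: (P i) => //.
exact: bmfunM.
Qed.

Lemma bmfun_integrable d (X : measurableType d) (mu : {measure set X -> \bar R}) (f : X -> R) :
  (mu setT < +oo)%E -> bmfun f -> mu.-integrable setT (EFin \o f).
Proof.
move=> muT [mf [M fM]]; apply: measurable_bounded_integrable => //.
by exists M; split; rewrite ?num_real// => x Mx y _ /=; rewrite (le_trans (fM y))// ltW.
Qed.

Context d d' (X : measurableType d) (Y : measurableType d').

Lemma bmfun_integrable_prod (m1 : {finite_measure set X -> \bar R})
    (m2 : {finite_measure set Y -> \bar R}) (f : X * Y -> R) :
  bmfun f -> (m1 \x m2)%E.-integrable setT (EFin \o f).
Proof.
apply: bmfun_integrable.
rewrite [ltLHS](_ : _ = m1 setT * m2 setT)%E; last first.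
  by rewrite -product_measure1E// setXTT.
by rewrite -ge0_fin_numE ?mule_ge0// fin_numM// fin_num_measure.
Qed.

Lemma bmfun_EFin_Rintegral1 (m1 : {finite_measure set X -> \bar R}) (f : X * Y -> R) y : bmfun f ->
  (\int[m1]_x f (x, y))%:E = (\int[m1]_x (f (x, y))%:E)%E.
Proof.
move=> bf; rewrite /Rintegral fineK//.
apply: integrable_fin_num => //; apply: bmfun_integrable.
  by rewrite -ge0_fin_numE// fin_num_measure.
by apply: (@bmfun_comp _ _ _ _ (pair ^~ y)) bf.
Qed.

Lemma bmfun_EFin_Rintegral2 (m2 : {finite_measure set Y -> \bar R}) (f : X * Y -> R) x : bmfun f ->
  (\int[m2]_y f (x, y))%:E = (\int[m2]_y (f (x, y))%:E)%E.
Proof.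
move=> bf; rewrite /Rintegral fineK//.
apply: integrable_fin_num => //; apply: bmfun_integrable.
  by rewrite -ge0_fin_numE// fin_num_measure.
by apply: (@bmfun_comp _ _ _ _ (pair x)) bf.
Qed.

Lemma bmfun_Rintegral2 (m2 : {finite_measure set Y -> \bar R}) (f : X * Y -> R) :
  bmfun f -> bmfun (fun x => \int[m2]_y f (x, y)).
Proof.
move=> bf; split.
  apply/measurable_EFinP.
  rewrite (_ : _ \o _ = fubini_F m2 (EFin \o f)).
    (* The product measure only serves to state measurability, so that any
       first factor will do. *)
    pose dirac0 : {finite_measure set X -> \bar R} := \d_(point : X).
    exact: (measurable_fubini_F (bmfun_integrable_prod dirac0 m2 bf)).
  by apply/funext => x /=; exact: bmfun_EFin_Rintegral2.
have [_ [M fM]] := bf; exists (M * fine (m2 setT)) => x.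
have bfx : bmfun (fun y => f (x, y)) by apply: (@bmfun_comp _ _ _ _ (pair x)) bf.
have m2T : (m2 setT < +oo)%E by rewrite -ge0_fin_numE// fin_num_measure.
rewrite (le_trans (le_normr_Rintegral _ (bmfun_integrable m2T bfx)))//.
rewrite -Rintegral_cst//; apply: le_Rintegral => //.
  apply: bmfun_integrable => //; split; last by exists M => y; rewrite normr_id.
  by apply: measurableT_comp; case: bfx.
by apply: bmfun_integrable => //; split => //; exists `|M|.
Qed.

Lemma bmfun_Fubini (m1 : {finite_measure set X -> \bar R})
    (m2 : {finite_measure set Y -> \bar R}) (f : X * Y -> R) : bmfun f ->
  \int[m1]_x \int[m2]_y f (x, y) = \int[m2]_y \int[m1]_x f (x, y).
Proof.
move=> bf.
transitivity (fine (\int[m1]_x \int[m2]_y (f (x, y))%:E)%E).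
  by congr fine; apply: eq_integral => x _; exact: bmfun_EFin_Rintegral2.
rewrite (Fubini (bmfun_integrable_prod m1 m2 bf)).
by congr fine; apply: eq_integral => y _; rewrite -bmfun_EFin_Rintegral1.
Qed.

End BoundedMeasurable.

(** * Finite product measures on tuples *)

Section TupleProduct.
Context (R : realType) (S : pmetricType R).
Notation B := (borel S).
Local Notation fmeasure := {finite_measure set B -> \bar R}.

Definition tcons n (p : B * n.-tuple B) : n.+1.-tuple B := [tuple of p.1 :: p.2].

Lemma measurable_tcons n : measurable_fun setT (@tcons n).
Proof. exact: measurable_cons. Qed.

(** [tuple_product] is a bare set function; the theorems on integrals require it to be packaged as a
    finite measure. *)
Lemma tuple_product_finite n (ms : 'I_n -> fmeasure) :
  exists q : {finite_measure set (n.-tuple B) -> \bar R},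
    q = tuple_product (fun i => ms i) :> (set (n.-tuple B) -> \bar R).
Proof.
elim: n ms => [|n IH] ms.
  pose q : {finite_measure set (0.-tuple B) -> \bar R} := \d_([tuple] : 0.-tuple B).
  by exists q.
have [q' qE] := IH (fun i => ms (lift ord0 i)).
pose mu0 := pushforward (ms ord0 \x q')%E (@tcons n) : {measure set (n.+1.-tuple B) -> \bar R}.
pose mu := mu0 (@measurable_tcons n).
have fin_mu : fin_num_fun mu.
  move=> A mA; rewrite ge0_fin_numE//.
  apply: (@le_lt_trans _ _ (mu setT)); first by apply: le_measure; rewrite ?inE.
  rewrite (_ : mu setT = ms ord0 setT * q' setT)%E.
    by rewrite -ge0_fin_numE ?mule_ge0// fin_numM// fin_num_measure.
  by rewrite -product_measure1E// setXTT.
pose q : {finite_measure set (n.+1.-tuple B) -> \bar R} :=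
  HB.pack (mu : set _ -> \bar R) (Measure.on mu) (@Measure_isFinite.Build _ _ _ mu fin_mu).
by exists q; rewrite /= -qE.
Qed.

Definition tproduct n (ms : 'I_n -> fmeasure) :
  {finite_measure set (n.-tuple B) -> \bar R} := sval (cid (tuple_product_finite ms)).

Lemma tproductE n (ms : 'I_n -> fmeasure) :
  tproduct ms = tuple_product (fun i => ms i) :> (set (n.-tuple B) -> \bar R).
Proof. by rewrite /tproduct; case: cid. Qed.

Lemma Rintegral_tproduct0 (ms : 'I_0 -> fmeasure) : \int[tproduct ms]_t 1 = 1.
Proof.
transitivity (fine (tproduct ms setT)); first by rewrite Rintegral_cst// mul1r.
have -> : tproduct ms setT = tuple_product (fun i => ms i) setT by rewrite tproductE.
by rewrite /tuple_product diracT.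
Qed.

Lemma tproductS n (ms : 'I_n.+1 -> fmeasure) :
  tproduct ms = pushforward (ms ord0 \x tproduct (fun i => ms (lift ord0 i)))%E
    (@tcons n) :> (set (n.+1.-tuple B) -> \bar R).
Proof. by rewrite !tproductE. Qed.

Local Open Scope ereal_scope.

Lemma ge0_integral_tproductS n (ms : 'I_n.+1 -> fmeasure)
    (f : n.+1.-tuple B -> \bar R) :
  measurable_fun setT f -> (forall t, 0 <= f t) ->
  \int[tproduct ms]_t f t =
  \int[ms ord0]_x \int[tproduct (fun i => ms (lift ord0 i))]_t f (tcons (x, t)).
Proof.
move=> mf f0; rewrite tproductS ge0_integral_pushforward//; last exact: measurable_tcons.
rewrite preimage_setT fubini_tonelli1//.
  exact: measurableT_comp (@measurable_tcons n).
by move=> p; exact: f0.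
Qed.

Local Close Scope ereal_scope.

(** The variable of index 0 is the inner one here, so that it can be eliminated while the others
    stay fixed. *)
Lemma Rintegral_tproductS n (ms : 'I_n.+1 -> fmeasure) (f : n.+1.-tuple B -> R) :
  bmfun f ->
  \int[tproduct ms]_t f t =
  \int[tproduct (fun i => ms (lift ord0 i))]_t \int[ms ord0]_x f (tcons (x, t)).
Proof.
move=> bf; have bft : bmfun (f \o @tcons n).
  by apply: bmfun_comp bf; exact: measurable_tcons.
transitivity (fine (\int[pushforward
    (ms ord0 \x tproduct (fun i => ms (lift ord0 i)))%E (@tcons n)]_t (f t)%:E)%E).
  by rewrite /Rintegral -tproductS.
rewrite integral_pushforward//; last 3 first.
- exact: measurable_tcons.
- by apply/measurable_EFinP; case: bf.
- exact: (bmfun_integrable_prod _ _ bft).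
rewrite preimage_setT -integral21_prod_meas1; last exact: (bmfun_integrable_prod _ _ bft).
congr fine; apply: eq_integral => t _.
exact: (esym (bmfun_EFin_Rintegral1 (ms ord0) t bft)).
Qed.

End TupleProduct.

(** * Elimination of variables in products of bounded kernels *)

Section KernelCycles.
Context (R : realType) (S : pmetricType R).
Notation B := (borel S).
Context (m : {finite_measure set B -> \bar R}).

Definition power_measure n := tproduct (fun _ : 'I_n => m).

Definition bkernel (F : B -> B -> R) := bmfun (fun p : B * B => F p.1 p.2).

Definition kcomp (F G : B -> B -> R) x y := \int[m]_z (F x z * G z y).

(* [kpow F k] is the [k.+1]-fold composition of [F]. *)
Definition kpow (F : B -> B -> R) k := iter k (kcomp^~ F) F.

Definition ktrace (F : B -> B -> R) := \int[m]_x F x x.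

Definition perm_integral n (s : 'I_n -> 'I_n) (F : 'I_n -> B -> B -> R) :=
  \int[power_measure n]_t \prod_j F j (tnth t j) (tnth t (s j)).

Let mT : (m setT < +oo)%E.
Proof. by rewrite -ge0_fin_numE// fin_num_measure. Qed.

Lemma bkernel_pair d (X : measurableType d) (F : B -> B -> R) (f g : X -> B) :
  bkernel F -> measurable_fun setT f -> measurable_fun setT g ->
  bmfun (fun x => F (f x) (g x)).
Proof.
move=> bF mf mg.
by apply: (@bmfun_comp _ _ _ _ _ (fun x => (f x, g x))) bF; exact: measurable_fun_pair.
Qed.

Lemma bkernel_comp F G : bkernel F -> bkernel G -> bkernel (kcomp F G).
Proof.
move=> bF bG.
apply: (@bmfun_Rintegral2 _ _ _ (B * B)%type B m
  (fun q : (B * B) * B => F q.1.1 q.2 * G q.2 q.1.2)).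
by apply: bmfunM; apply: bkernel_pair => //; exact: measurableT_comp.
Qed.

Lemma kcompA F G H : bkernel F -> bkernel G -> bkernel H ->
  kcomp F (kcomp G H) = kcomp (kcomp F G) H.
Proof.
move=> bF bG bH; apply/funext => x; apply/funext => y; rewrite /kcomp.
have bL : bmfun (fun q : B * B => F x q.1 * (G q.1 q.2 * H q.2 y)).
  by apply: bmfunM; [|apply: bmfunM]; apply: bkernel_pair.
transitivity (\int[m]_z \int[m]_w (F x z * (G z w * H w y))).
  apply: eq_Rintegral => z _; rewrite RintegralZl//.
  by apply: bmfun_integrable => //; apply: bmfunM; apply: bkernel_pair.
rewrite (bmfun_Fubini m m bL); apply: eq_Rintegral => w _ /=.
under eq_Rintegral do rewrite mulrA.
rewrite RintegralZr//.
by apply: bmfun_integrable => //; apply: bmfunM; apply: bkernel_pair.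
Qed.

Lemma bkernel_pow F k : bkernel F -> bkernel (kpow F k).
Proof. by move=> bF; elim: k => //= k IH; exact: bkernel_comp. Qed.

(** The exponent is one less than the number of factors: (a + 1) + (b + 1) = (a + b + 1) + 1. *)
Lemma kcomp_pow F a b : bkernel F ->
  kcomp (kpow F a) (kpow F b) = kpow F (a + b).+1.
Proof.
move=> bF; elim: b => [|b IH]; first by rewrite addn0.
rewrite [kpow F b.+1]/= -/(kpow F b) kcompA ?IH ?addnS//; exact: bkernel_pow.
Qed.

Lemma tnth_tcons0 n (p : B * n.-tuple B) : tnth (tcons p) ord0 = p.1.
Proof. by rewrite (tnth_nth p.1). Qed.

Lemma tnth_tconsS n (p : B * n.-tuple B) i :
  tnth (tcons p) (lift ord0 i) = tnth p.2 i.
Proof. by rewrite /tcons tnthS. Qed.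

Lemma bmfun_perm_prod n (s : 'I_n -> 'I_n) (F : 'I_n -> B -> B -> R) (P : pred 'I_n) :
  (forall j, bkernel (F j)) ->
  bmfun (fun t : n.-tuple B => \prod_(j | P j) F j (tnth t j) (tnth t (s j))).
Proof.
move=> bF; apply: (@bmfun_prod R _ _ _ _ P (fun j (t : n.-tuple B) => F j (tnth t j) (tnth t (s j)))) => j.
by apply: bkernel_pair => //; exact: measurable_tnth.
Qed.

(** The variable 0 occurs only in the factor F_0(x_0, x_0), whose integral is a trace. *)
Lemma perm_integral_fix n (s : 'I_n.+1 -> 'I_n.+1) (s' : 'I_n -> 'I_n)
    (F : 'I_n.+1 -> B -> B -> R) : (forall j, bkernel (F j)) ->
  s ord0 = ord0 -> (forall j, s (lift ord0 j) = lift ord0 (s' j)) ->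
  perm_integral s F =
    ktrace (F ord0) * perm_integral s' (fun j => F (lift ord0 j)).
Proof.
move=> bF s0 sS; rewrite /perm_integral Rintegral_tproductS; last exact: bmfun_perm_prod.
rewrite -RintegralZl//; last first.
  apply: bmfun_integrable; last exact: (@bmfun_perm_prod n s' (fun j => F (lift ord0 j)) xpredT).
  by rewrite -ge0_fin_numE// fin_num_measure.
apply: eq_Rintegral => t _.
rewrite -RintegralZr//; last by apply: bmfun_integrable => //; exact: bkernel_pair.
apply: eq_Rintegral => x _; rewrite big_ord_recl s0 !tnth_tcons0; congr (_ * _).
by apply: eq_bigr => j _; rewrite sS !tnth_tconsS.
Qed.

(** The variable 0 occurs in exactly two factors, as the second argument of the kernel of its
    predecessor [j0] and as the first argument of [F ord0]; integrating over it composes the two. *)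
Lemma perm_integral_comp n (s : 'I_n.+1 -> 'I_n.+1) (s' : 'I_n -> 'I_n)
    (j0 : 'I_n) (F : 'I_n.+1 -> B -> B -> R) : (forall j, bkernel (F j)) ->
  s (lift ord0 j0) = ord0 -> s ord0 = lift ord0 (s' j0) ->
  (forall j, j != j0 -> s (lift ord0 j) = lift ord0 (s' j)) ->
  perm_integral s F = perm_integral s' (fun j =>
    if j == j0 then kcomp (F (lift ord0 j0)) (F ord0) else F (lift ord0 j)).
Proof.
move=> bF sj0 s0 sS; rewrite /perm_integral Rintegral_tproductS; last exact: bmfun_perm_prod.
apply: eq_Rintegral => t _.
rewrite [RHS](bigD1 j0)//= eqxx /kcomp -RintegralZr//; last first.
  by apply: bmfun_integrable => //; apply: bmfunM; exact: bkernel_pair.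
apply: eq_Rintegral => x _; rewrite big_ord_recl s0 (bigD1 j0)//= sj0.
rewrite !tnth_tcons0 !tnth_tconsS mulrA; congr (_ * _); first by rewrite mulrC.
by apply: eq_bigr => j jj0; rewrite sS// !tnth_tconsS (negPf jj0).
Qed.

(* [skip0 s] is [s] with [ord0] removed from its cycle. When [ord0] is a fixed
   point of [s], the test is false, and [odflt] never returns its default for
   an injective [s]. *)
Definition skip0 n (s : 'I_n.+1 -> 'I_n.+1) (j : 'I_n) : 'I_n :=
  odflt j (unlift ord0 (if s (lift ord0 j) == ord0 then s ord0 else s (lift ord0 j))).

Lemma lift_skip0 n (s : 'I_n.+1 -> 'I_n.+1) j : injective s ->
  lift ord0 (skip0 s j) = if s (lift ord0 j) == ord0 then s ord0 else s (lift ord0 j).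
Proof.
move=> si; rewrite /skip0; case: ifPn => sj.
  case: unliftP => //= s0; have /si/eqP := etrans (eqP sj) (esym s0).
  by rewrite eq_sym (negPf (neq_lift _ _)).
by case: unliftP sj => //= ->; rewrite eqxx.
Qed.

Lemma skip0_inj n (s : 'I_n.+1 -> 'I_n.+1) : injective s -> injective (skip0 s).
Proof.
move=> si i j /(congr1 (lift ord0)); rewrite !lift_skip0//.
case: ifPn => /eqP i0; case: ifPn => /eqP j0.
- by move=> _; apply: (@lift_inj _ ord0); apply: si; rewrite i0 j0.
- by move=> /si/eqP; rewrite (negPf (neq_lift _ _)).
- by move=> /si/eqP; rewrite eq_sym (negPf (neq_lift _ _)).
- by move=> /si/lift_inj.
Qed.

(* Integrating over the variable [0] either splits off the trace of a fixed
   point or replaces two consecutive kernels of a cycle by their composition;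
   for this induction the kernels are arbitrary powers of [F]. *)
Lemma perm_integral_factor n (s : 'I_n -> 'I_n) (k : 'I_n -> nat) :
  injective s -> (forall j, s j = j -> (0 < k j)%N) ->
  exists ls : seq nat, [/\ all (ltn 0) ls, (\sum_(l <- ls) l.+1 = \sum_j (k j).+1)%N &
    forall F, bkernel F ->
      perm_integral s (fun j => kpow F (k j)) = \prod_(l <- ls) ktrace (kpow F l)].
Proof.
elim: n s k => [|n IH] s k si k0.
  exists [::]; split => //; first by rewrite big_nil big_ord0.
  move=> F bF; rewrite big_nil /perm_integral.
  under eq_Rintegral do rewrite big_ord0.
  exact: Rintegral_tproduct0.
have [s0|s0] := eqVneq (s ord0) ord0.
  have sS j : s (lift ord0 j) = lift ord0 (skip0 s j).
    rewrite lift_skip0//; case: eqP => // s00; have /si/eqP := etrans s00 (esym s0).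
    by rewrite eq_sym (negPf (neq_lift _ _)).
  have [|ls [ls0 lsS lsF]] := IH (skip0 s) (fun j => k (lift ord0 j)) (skip0_inj si).
    by move=> j jj; apply: k0; rewrite sS jj.
  exists (k ord0 :: ls); split; first by rewrite /= ls0 k0.
    by rewrite big_cons lsS big_ord_recl.
  move=> F bF; rewrite (perm_integral_fix (s' := skip0 s))//.
    by rewrite lsF// big_cons.
  by move=> j; exact: bkernel_pow.
have [j0' sj0'] : exists j, s j = ord0.
  by exists (invF si ord0); rewrite f_invF.
have [j0 j0E|j00] := unliftP ord0 j0'; last by move: s0; rewrite -{1}j00 sj0' eqxx.
rewrite {}j0E in sj0'.
have sS j : j != j0 -> s (lift ord0 j) = lift ord0 (skip0 s j).
  move=> jj0; rewrite lift_skip0//; case: eqP => // sj.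
  by have /si/lift_inj jE := etrans sj (esym sj0'); rewrite jE eqxx in jj0.
have s0S : s ord0 = lift ord0 (skip0 s j0) by rewrite lift_skip0// sj0' eqxx.
pose k' j := if j == j0 then (k (lift ord0 j0) + k ord0).+1 else k (lift ord0 j).
have [|ls [ls0 lsS lsF]] := IH (skip0 s) k' (skip0_inj si).
  (* A fixed point created by the elimination can only be [j0], where the exponent has become
     positive; any other one was already a fixed point of [s]. *)
  move=> j jj; rewrite /k'; case: eqP => // /eqP jj0; apply: k0.
  by rewrite sS// jj.
exists ls; split => //.
  rewrite lsS big_ord_recl (bigD1 j0)//= [in RHS](bigD1 j0)//= /k' eqxx.
  rewrite (eq_bigr (fun j => (k (lift ord0 j)).+1)); last by move=> j /negPf ->.
  by rewrite /=; lia.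
move=> F bF; rewrite -lsF// (perm_integral_comp (s' := skip0 s) (j0 := j0))//.
  congr perm_integral; apply/funext => j; rewrite /k'; case: eqP => // _.
  exact: kcomp_pow.
by move=> j; exact: bkernel_pow.
Qed.

(** On a single cycle, the eliminations compose all the kernels and leave one trace. There are (n +
    1) + sum_j k_j factors in all, one more than the exponent. *)
Lemma perm_integral_ordS n (k : 'I_n.+1 -> nat) F : bkernel F ->
  perm_integral (@ordS n.+1) (fun j => kpow F (k j)) =
  ktrace (kpow F (n + \sum_j k j)).
Proof.
elim: n k => [|n IH] k bF.
  rewrite (perm_integral_fix (s' := id))//.
  - rewrite /perm_integral; under eq_Rintegral do rewrite big_ord0.
    by rewrite Rintegral_tproduct0 mulr1 big_ord1.
  - by move=> j; exact: bkernel_pow.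
  - exact/val_inj.
  - by case.
(* The cyclic predecessor of 0 is the last vertex, and removing 0 leaves a cycle with one vertex
   less. *)
rewrite (perm_integral_comp (s' := @ordS n.+1) (j0 := ord_max)).
- pose k' j := if j == ord_max then (k (lift ord0 ord_max) + k ord0).+1 else k (lift ord0 j).
  transitivity (perm_integral (@ordS n.+1) (fun j => kpow F (k' j))).
    congr perm_integral; apply/funext => j; rewrite /k'; case: eqP => // _.
    exact: kcomp_pow.
  rewrite IH//; congr (ktrace (kpow F _)).
  rewrite [in RHS]big_ord_recl (bigD1 ord_max)//= [in RHS](bigD1 ord_max)//= /k' eqxx.
  rewrite (eq_bigr (fun j => k (lift ord0 j))); last by move=> j /negPf ->.
  by rewrite /=; lia.
- by move=> j; exact: bkernel_pow.
- by apply/val_inj; rewrite /= modnn.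
- by apply/val_inj; rewrite /= modnn.
- move=> j jmax; apply/val_inj => /=.
  have jn : (j < n)%N.
      rewrite ltn_neqAle -ltnS ltn_ord andbT.
      by apply: contra jmax => /eqP jn; exact/eqP/val_inj.
  by rewrite /bump/= !add1n !modn_small.
Qed.

End KernelCycles.

(** * Factorization over cycles for unbounded kernels *)

Section UnboundedKernels.
Context (R : realType) (S : pmetricType R).
Notation B := (borel S).
Context (m : {finite_measure set B -> \bar R}).

Definition derangement n (s : 'I_n -> 'I_n) := injective s /\ forall j, s j <> j.

Lemma derangement_ordS n : (1 < n)%N -> derangement (@ordS n).
Proof.
move=> n1; split; first exact: ordS_inj.
move=> j /(congr1 val)/= jE; have jn := ltn_ord j.
have [jn1|] := ltnP j.+1 n; first by move: jE; rewrite modn_small//; lia.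
move=> njn; have jS : j.+1 = n by lia.
by move: jE; rewrite jS modnn; lia.
Qed.

(** Integrability is asked only along maps without fixed points, so that F(x, x) is never integrated
    on its own. *)
Definition kernel_integrable (F : B -> B -> R) :=
  measurable_fun setT (fun p : B * B => F p.1 p.2) /\
  forall n (s : 'I_n -> 'I_n), derangement s ->
    (power_measure m n).-integrable setT
      (fun t : n.-tuple B => (\prod_j F (tnth t j) (tnth t (s j)))%:E).

Let trunc (F : B -> B -> R) (M : nat) x y :=
  if `|F x y| <= M%:R then F x y else 0.

Let bkernel_trunc F M : kernel_integrable F -> bkernel (trunc F M).
Proof.
move=> [mF _]; split.
  apply: measurable_fun_ifT => //; apply: measurable_fun_ler => //.
  exact: measurableT_comp.
by exists M%:R => p; rewrite /trunc; case: ifP; rewrite ?normr0.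
Qed.

(* Kernels are truncated because the compositions [kcomp] of an unbounded one
   need not be defined, although its integrals along derangements are. *)
Lemma perm_integral_trunc_cvg F n (s : 'I_n -> 'I_n) :
  kernel_integrable F -> derangement s ->
  perm_integral m s (fun=> trunc F M) @[M --> \oo] --> perm_integral m s (fun=> F).
Proof.
move=> iF ds; have [mF /(_ _ _ ds) iFs] := iF.
pose f (t : n.-tuple B) := (\prod_j F (tnth t j) (tnth t (s j)))%:E.
pose f_ (M : nat) (t : n.-tuple B) := (\prod_j trunc F M (tnth t j) (tnth t (s j)))%:E.
have [] := @dominated_convergence _ _ R (power_measure m n) setT measurableT f_ f (abse \o f).
- move=> M; apply/measurable_EFinP.
  by have [] := @bmfun_perm_prod R S n s (fun=> trunc F M) xpredT (fun=> bkernel_trunc M iF).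
- exact: measurable_int iFs.
- apply: aeW => t _; apply: cvg_near_cst.
  (* Once [M] exceeds the sum of the absolute values of the factors at [t], no factor is truncated:
     the sequence is eventually constant. *)
  exists (Num.truncn (\sum_j `|F (tnth t j) (tnth t (s j))|)).+1 => // M /= KM.
  rewrite /f_ /f; congr EFin; apply: eq_bigr => j _; rewrite /trunc ifT//.
  apply: (@le_trans _ _ (\sum_j `|F (tnth t j) (tnth t (s j))|)).
    by rewrite (bigD1 j)//= lerDl sumr_ge0.
  rewrite (le_trans (ltW (truncnS_gt _)))//.
  by rewrite ler_nat.
- exact: integrable_abse.
- apply: aeW => t M _; rewrite /f_ /f/= lee_fin !normr_prod.
  apply: ler_prod => j _; rewrite normr_ge0/= /trunc; case: ifP => // _.
  by rewrite normr0.
move=> _ _ fcvg; rewrite /perm_integral /Rintegral.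
apply: fine_cvg; rewrite fineK//; exact: integrable_fin_num.
Qed.

(** The factorization holds for every truncation, with cycle lengths [ls] that depend on [s] only;
    both sides converge as the truncation level grows. Each cycle has length at least 2, so it is
    itself a derangement and the convergence applies to it. *)
Lemma perm_integral_cycles n (s : 'I_n -> 'I_n) : derangement s ->
  exists ls : seq nat, [/\ all (ltn 0) ls, (\sum_(l <- ls) l.+1 = n)%N &
    forall F, kernel_integrable F -> perm_integral m s (fun=> F) =
      \prod_(l <- ls) perm_integral m (@ordS l.+1) (fun=> F)].
Proof.
move=> ds; have [si sd] := ds.
have [|ls [ls0 lsn lsF]] := perm_integral_factor m (k := fun=> 0%N) si.
  by move=> j /sd.
exists ls; split => //; first by rewrite lsn sum_nat_const card_ord muln1.
move=> F iF.
have truncE M : perm_integral m s (fun=> trunc F M) =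
    \prod_(l <- ls) perm_integral m (@ordS l.+1) (fun=> trunc F M).
  rewrite (lsF _ (bkernel_trunc M iF)); apply: eq_bigr => l _.
  have := perm_integral_ordS m (fun _ : 'I_l.+1 => 0%N) (bkernel_trunc M iF).
  by move=> ->; rewrite big1// addn0.
apply: (@cvg_unique _ (@Rhausdorff R) _ _ _ _ (perm_integral_trunc_cvg iF ds)).
rewrite /= (funext truncE).
elim: ls ls0 {lsn lsF truncE} => [_|l ls IH /= /andP[l0 /IH H]].
  by under eq_fun do rewrite big_nil; rewrite big_nil; exact: cvg_cst.
under eq_fun do rewrite big_cons; rewrite big_cons; apply: cvgM => //.
by apply: perm_integral_trunc_cvg => //; exact: derangement_ordS.
Qed.

Lemma perm_integral_le n (s : 'I_n -> 'I_n) F (c : R) :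
  kernel_integrable F -> derangement s ->
  (forall l, (1 < l)%N -> `|perm_integral m (@ordS l) (fun=> F)| <= c ^+ l) ->
  `|perm_integral m s (fun=> F)| <= c ^+ n.
Proof.
move=> iF ds Fc; have [ls [ls0 lsn lsF]] := perm_integral_cycles ds.
rewrite lsF// normr_prod -lsn.
elim: ls ls0 {lsn lsF} => [_|l ls IH /= /andP[l0 /IH H]]; first by rewrite !big_nil expr0.
by rewrite !big_cons exprD ler_pM// ?Fc// prodr_ge0.
Qed.

End UnboundedKernels.

(** * Signed integrals in terms of densities *)

Lemma Rintegral_sumZ (R : realType) d (X : measurableType d) (mu : {measure set X -> \bar R})
    (I : Type) (s : seq I) (P : pred I) (c : I -> R) (g : I -> X -> R) :
  (forall i, mu.-integrable setT (fun x => (g i x)%:E)) ->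
  \int[mu]_x (\sum_(i <- s | P i) c i * g i x) = \sum_(i <- s | P i) c i * \int[mu]_x g i x.
Proof.
move=> ig; have icg i : mu.-integrable setT (fun x => (c i * g i x)%:E).
  by under eq_fun do rewrite EFinM; exact: integrableZl.
elim: s => [|i s IH].
  by under eq_Rintegral do rewrite big_nil; rewrite Rintegral_cst// mul0r big_nil.
rewrite big_cons -IH -RintegralZl//; last exact: ig.
under eq_Rintegral do rewrite big_cons; case: (P i) => //.
rewrite RintegralD//; first exact: icg.
rewrite (_ : EFin \o _ = fun x => \sum_(j <- s | P j) (c j * g j x)%:E)%E.
  exact: integrable_sum.
by apply/funext => x; rewrite sumEFin.
Qed.

(** The Radon-Nikodym derivative of [p] agrees with [g] almost everywhere, since both have the same
    integral over every measurable set. *)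
Lemma ge0_integral_density (R : realType) d (X : measurableType d)
    (m p : {finite_measure set X -> \bar R}) (g : X -> R) (f : X -> \bar R) :
  measurable_fun setT g -> (forall x, 0 <= g x) ->
  (forall A, measurable A -> p A = \int[m]_(x in A) (g x)%:E)%E ->
  measurable_fun setT f -> (forall x, 0 <= f x)%E ->
  (\int[p]_x f x = \int[m]_x (f x * (g x)%:E))%E.
Proof.
move=> mg g0 pg mf f0.
have pm : p `<< m.
  apply/null_content_dominatesP => A mA mA0.
  rewrite [LHS]pg// null_set_integral//.
  by apply: measurable_funTS; exact/measurable_EFinP.
rewrite -(Radon_Nikodym_SigmaFinite.change_of_variables pm f0)//.
set D := Radon_Nikodym_SigmaFinite.f p m.
have iD : m.-integrable setT D by exact: Radon_Nikodym_SigmaFinite.f_integrable.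
have mD := measurable_int _ iD.
have DgE : ae_eq m setT D (EFin \o g).
  apply: integral_ae_eq => //; first exact/measurable_EFinP.
  by move=> A _ mA; rewrite -Radon_Nikodym_SigmaFinite.f_integral// pg.
apply: ae_eq_integral => //; [exact: emeasurable_funM| |].
  by apply: emeasurable_funM => //; exact/measurable_EFinP.
by move: DgE; apply: filterS => x /(_ I) DE _; rewrite DE.
Qed.

(** * Densities of signed measures and of their Jordan parts *)

Section SignedDensity.
Context (R : realType) (S : pmetricType R).
Notation B := (borel S).
Context (m : {finite_measure set B -> \bar R}).
Implicit Types (nu : signed_measure S) (h : B -> R).

(** The positive part for [false] and the negative part for [true], matching the convention of
    [jordan]. *)
Definition sign_part (b : bool) (r : R) := Num.max ((-1) ^+ b * r) 0.

Lemma sign_part_ge0 b r : 0 <= sign_part b r.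
Proof. by rewrite le_max lexx orbT. Qed.

Lemma sign_partB r : sign_part false r - sign_part true r = r.
Proof.
rewrite /sign_part expr0 expr1 mul1r mulN1r /Num.max.
by case: ltP => ?; case: ltP => ?; lra.
Qed.

Lemma sign_partD r : sign_part false r + sign_part true r = `|r|.
Proof.
rewrite /sign_part expr0 expr1 mul1r mulN1r /Num.max.
by case: (ltrP r 0) => r0; [rewrite ltr0_norm//|rewrite ger0_norm//]; case: ltP => ?; lra.
Qed.

Lemma measurable_sign_part b : measurable_fun setT (sign_part b).
Proof. by apply: measurable_maxr => //; exact: measurable_funM. Qed.

Definition has_density nu h := m.-integrable setT (EFin \o h) /\
  forall A, measurable A -> (nu A = \int[m]_(x in A) (h x)%:E)%E.

Lemma has_density_measurable nu h : has_density nu h -> measurable_fun setT h.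
Proof. by move=> [ih _]; apply/measurable_EFinP; exact: measurable_int ih. Qed.

(** The sets where [h] is nonnegative and where it is negative form a Hahn decomposition, and such
    decompositions are unique up to null sets. *)
Lemma jordan_density b nu h A : has_density nu h -> measurable A ->
  (jordan b nu A = \int[m]_(x in A) (sign_part b (h x))%:E)%E.
Proof.
move=> dh mA; have [ih nuh] := dh; have mh := has_density_measurable dh.
pose Q := [set x | 0 <= h x]; pose Q' := [set x | h x < 0].
have mQ : measurable Q.
  by rewrite -[Q]setTI; apply: measurable_fun_le => //; exact: measurable_cst.
have QC : ~` Q = Q' by apply/seteqP; split=> x; rewrite /Q/Q'/= ltNge => /negP.
have mQ' : measurable Q' by rewrite -QC; exact: measurableC.
have intQ' E : E `<=` Q' -> (\int[m]_(x in E) (h x)%:E = - \int[m]_(x in E) (- h x)%:E)%E.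
  move=> EQ; rewrite -integral_ge0N; last by move=> x /EQ/ltW; rewrite lee_fin oppr_ge0.
  by apply: eq_integral => x _; rewrite -EFinN opprK.
have hQ : hahn_decomposition nu Q Q'.
  split.
  - split => // E mE EQ; rewrite nuh//; apply: integral_ge0 => x /EQ.
    by rewrite lee_fin.
  - split => // E mE EQ; rewrite nuh// -oppe_ge0.
    rewrite (intQ' _ EQ).
    rewrite oppeK; apply: integral_ge0 => x /EQ /ltW.
    by rewrite lee_fin oppr_ge0.
  - by rewrite -QC setUv.
  - by rewrite -QC setICr.
have [EP EN] := Hahn_decomposition_uniq (hahn nu) hQ mA.
rewrite /jordan; case: b.
  rewrite jordan_negE cjordan_negE /crestr0 mem_set// /crestr EN nuh; last exact: measurableI.
  rewrite intQ'; last by move=> x [].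
  rewrite oppeK integral_mkcondr; apply: eq_integral => x _.
  rewrite patchE /sign_part expr1 mulN1r /Num.max; case: ifPn; rewrite ?inE ?notin_setE/Q'/=.
    by move=> hx; rewrite ifF//; apply/negbTE; rewrite -leNgt oppr_ge0 ltW.
  move=> /negP; rewrite -leNgt => hx; case: ltP => //; rewrite oppr_ge0 => hx'.
    by congr EFin; apply/eqP; rewrite eq_sym oppr_eq0 eq_le hx hx'.
rewrite jordan_posE cjordan_posE /crestr0 mem_set// /crestr EP nuh; last exact: measurableI.
rewrite integral_mkcondr; apply: eq_integral => x _.
rewrite patchE /sign_part expr0 mul1r /Num.max; case: ifPn; rewrite ?inE ?notin_setE/Q/=.
  by move=> hx; rewrite ltNge hx.
by move=> /negP; rewrite -ltNge => ->.
Qed.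

End SignedDensity.

(** * Signed integrals as integrals against a product density *)

Section SignedIntegral.
Context (R : realType) (S : pmetricType R).
Notation B := (borel S).
Local Notation fmeasure := {finite_measure set B -> \bar R}.
Context (m : fmeasure).
Implicit Types (nu : signed_measure S) (h : B -> R).

Definition jordan_measure b nu : fmeasure :=
  if b then (jordan_neg (hahn nu) : fmeasure) else (jordan_pos (hahn nu) : fmeasure).

Lemma jordan_measureE b nu : jordan_measure b nu = jordan b nu :> (set B -> \bar R).
Proof. by case: b. Qed.

Lemma variation_finite nu : exists v : fmeasure, v = Defs.variation nu :> (set B -> \bar R).
Proof.
pose mu : {measure set B -> \bar R} := charge_variation (hahn nu).
have fin_mu : fin_num_fun mu by move=> A mA; exact: fin_num_measure.
pose q : fmeasure := HB.pack (mu : set _ -> \bar R) (Measure.on mu)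
  (@Measure_isFinite.Build _ _ _ mu fin_mu).
by exists q.
Qed.

Definition variation_measure nu : fmeasure := sval (cid (variation_finite nu)).

Lemma variation_measureE nu : variation_measure nu = Defs.variation nu :> (set B -> \bar R).
Proof. by rewrite /variation_measure; case: cid. Qed.

Lemma variation_density nu h A : has_density m nu h -> measurable A ->
  (Defs.variation nu A = \int[m]_(x in A) `|h x|%:E)%E.
Proof.
move=> dh mA; have mh := has_density_measurable dh.
transitivity (jordan false nu A + jordan true nu A)%E; first by [].
rewrite !(jordan_density _ dh)// -ge0_integralD//.
- by apply: eq_integral => x _; rewrite -EFinD sign_partD.
- by move=> x _; rewrite lee_fin sign_part_ge0.
- apply: measurable_funTS; apply/measurable_EFinP.
  exact: measurableT_comp (measurable_sign_part _) mh.
- by move=> x _; rewrite lee_fin sign_part_ge0.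
- apply: measurable_funTS; apply/measurable_EFinP.
  exact: measurableT_comp (measurable_sign_part _) mh.
Qed.

Lemma measurable_prod_tnth n (g : 'I_n -> B -> R) :
  (forall i, measurable_fun setT (g i)) ->
  measurable_fun setT (fun t : n.-tuple B => \prod_i g i (tnth t i)).
Proof.
move=> mg; apply: measurable_prod => i _.
by apply: measurableT_comp (mg i) _; exact: measurable_tnth.
Qed.

(** Induction on [n] by Tonelli's theorem, changing the measure of one variable at a time. *)
Lemma tproduct_density n (ps : 'I_n -> fmeasure) (g : 'I_n -> B -> R)
    (f : n.-tuple B -> \bar R) :
  (forall i, measurable_fun setT (g i)) -> (forall i x, 0 <= g i x) ->
  (forall i A, measurable A -> ps i A = \int[m]_(x in A) (g i x)%:E)%E ->
  measurable_fun setT f -> (forall t, 0 <= f t)%E ->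
  (\int[tproduct ps]_t f t =
   \int[power_measure m n]_t (f t * (\prod_i g i (tnth t i))%:E))%E.
Proof.
elim: n ps g f => [|n IH] ps g f mg g0 pg mf f0.
  have -> : ps = fun=> m by apply/funext; case.
  by apply: eq_integral => t _; rewrite big_ord0 mule1.
have mtc : measurable_fun setT (fun p => f (@tcons R S n p)).
  exact: measurableT_comp mf (@measurable_tcons R S n).
have mg' : measurable_fun setT (fun t : n.-tuple B => \prod_i g (lift ord0 i) (tnth t i)).
  by apply: (@measurable_prod_tnth n (fun i => g (lift ord0 i))).
have g'0 (t : n.-tuple B) : 0 <= \prod_i g (lift ord0 i) (tnth t i).
  by apply: prodr_ge0.
have mF : measurable_fun setT (fun p : B * n.-tuple B =>
    f (tcons p) * (\prod_i g (lift ord0 i) (tnth p.2 i))%:E)%E.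
  apply: emeasurable_funM => //; apply/measurable_EFinP.
  exact: measurableT_comp mg' measurable_snd.
have F0 p : (0 <= f (@tcons R S n p) * (\prod_i g (lift ord0 i) (tnth p.2 i))%:E)%E.
  by rewrite mule_ge0// lee_fin.
rewrite !ge0_integral_tproductS//; last 2 first.
- apply: emeasurable_funM => //; apply/measurable_EFinP; exact: measurable_prod_tnth.
- by move=> t; rewrite mule_ge0// lee_fin prodr_ge0.
have IHx x : (\int[tproduct (fun i => ps (lift ord0 i))]_t f (tcons (x, t)) =
    \int[power_measure m n]_t (f (tcons (x, t)) * (\prod_i g (lift ord0 i) (tnth t i))%:E))%E.
  apply: (IH _ (fun i => g (lift ord0 i)) (fun t => f (tcons (x, t)))) => //.
    by move=> i A mA; exact: pg.
  exact: (measurableT_comp mtc (pair1_measurable x)).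
under eq_integral do rewrite IHx.
rewrite (ge0_integral_density (mg ord0) (g0 ord0) (pg ord0))//; last 2 first.
- exact: (@measurable_fun_fubini_tonelli_F _ _ _ _ _ (power_measure m n) _ mF F0).
- by move=> x; apply: integral_ge0 => t _; exact: (F0 (x, t)).
apply: eq_integral => x _.
rewrite -ge0_integralZr//; last 2 first.
- exact: (measurableT_comp mF (pair1_measurable x)).
- by rewrite lee_fin.
apply: eq_integral => t _; rewrite -muleA; congr (_ * _)%E.
rewrite -EFinM big_ord_recl tnth_tcons0 mulrC; congr (_ * _)%:E.
by apply: eq_bigr => i _; rewrite tnth_tconsS.
Qed.

Section Densities.
Context (n : nat) (nu : 'I_n -> signed_measure S) (h : 'I_n -> B -> R).
Hypothesis nuh : forall i, has_density m (nu i) (h i).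
Implicit Types f : n.-tuple B -> \bar R.

Let mh i : measurable_fun setT (h i).
Proof. exact: has_density_measurable (nuh i). Qed.

(** The density of [jordan_product nu s] with respect to [power_measure m n]. *)
Definition sign_weight (s : {ffun 'I_n -> bool}) (t : n.-tuple B) : R :=
  \prod_i sign_part (s i) (h i (tnth t i)).

Lemma sign_weight_ge0 s t : 0 <= sign_weight s t.
Proof. by apply: prodr_ge0 => i _; exact: sign_part_ge0. Qed.

Lemma measurable_sign_weight s : measurable_fun setT (sign_weight s).
Proof.
apply: (@measurable_prod_tnth n (fun i x => sign_part (s i) (h i x))) => i.
exact: measurableT_comp (measurable_sign_part _) (mh i).
Qed.

(** Distributivity for the product of the differences h_i = h_i^+ - h_i^-. *)
Lemma sign_weight_sum t :
  \sum_s (-1) ^+ minus_sign s * sign_weight s t = \prod_i h i (tnth t i).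
Proof.
transitivity (\prod_i \sum_(b : bool) (-1) ^+ b * sign_part b (h i (tnth t i))).
  rewrite bigA_distr_bigA; apply: eq_bigr => s _.
  rewrite big_split/= -/(sign_weight s t); congr (_ * _).
  rewrite prodrXr /minus_sign signr_odd -sum1_card big_mkcond/=; congr (_ ^+ _).
  by apply: eq_bigr => i _; rewrite inE; case: (s i).
apply: eq_bigr => i _.
by rewrite big_bool/= expr1 expr0 mul1r mulN1r addrC sign_partB.
Qed.

Lemma sign_weight_le s t : sign_weight s t <= `|\prod_i h i (tnth t i)|.
Proof.
rewrite normr_prod; apply: ler_prod => i _; rewrite sign_part_ge0/= -sign_partD.
by case: (s i); rewrite ?lerDl ?lerDr sign_part_ge0.
Qed.

Lemma integral_jordan_product s f :
  measurable_fun setT f -> (forall t, 0 <= f t)%E ->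
  (\int[jordan_product nu s]_t f t =
   \int[power_measure m n]_t (f t * (sign_weight s t)%:E))%E.
Proof.
move=> mf f0.
have -> : jordan_product nu s = tproduct (fun i => jordan_measure (s i) (nu i)) :> (set _ -> \bar R).
  rewrite tproductE /jordan_product; congr tuple_product; apply/funext => i.
  by rewrite jordan_measureE.
apply: (tproduct_density (g := fun i x => sign_part (s i) (h i x))) => //.
- by move=> i; exact: measurableT_comp (measurable_sign_part _) (mh i).
- by move=> i x; exact: sign_part_ge0.
- move=> i A mA; rewrite -(jordan_density _ (nuh i))//.
  by rewrite jordan_measureE.
Qed.

Lemma integral_variation_product f :
  measurable_fun setT f -> (forall t, 0 <= f t)%E ->
  (\int[tuple_product (fun i => Defs.variation (nu i))]_t f t =
   \int[power_measure m n]_t (f t * `|\prod_i h i (tnth t i)|%:E))%E.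
Proof.
move=> mf f0.
have -> : tuple_product (fun i => Defs.variation (nu i)) =
    tproduct (fun i => variation_measure (nu i)) :> (set _ -> \bar R).
  rewrite tproductE; congr tuple_product; apply/funext => i.
  by rewrite variation_measureE.
under [RHS]eq_integral do rewrite normr_prod.
apply: (tproduct_density (g := fun i x => `|h i x|)) => //.
- by move=> i; exact: measurableT_comp (mh i).
- move=> i A mA; rewrite -(variation_density (nuh i))//.
  by rewrite variation_measureE.
Qed.

Lemma signed_integrableP f : measurable_fun setT f ->
  signed_integrable nu f <->
  (power_measure m n).-integrable setT (fun t => f t * (\prod_i h i (tnth t i))%:E)%E.
Proof.
move=> mf; rewrite /signed_integrable integral_variation_product//; last exact: measurableT_comp.
have mfh : measurable_fun setT (fun t => f t * (\prod_i h i (tnth t i))%:E)%E.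
  by apply: emeasurable_funM => //; apply/measurable_EFinP; exact: measurable_prod_tnth.
have -> : (\int[power_measure m n]_t (`|f t| * `|\prod_i h i (tnth t i)|%:E) =
   \int[power_measure m n]_t `|f t * (\prod_i h i (tnth t i))%:E|)%E.
  by apply: eq_integral => t _; rewrite abseM.
by split=> [[_ fi]|/integrableP[]//]; apply/integrableP.
Qed.

(** Against each weight [f] is integrable, so all the terms of the positive and negative integrals
    are finite and can be regrouped; the weights recombine into the product of the densities. *)
Lemma signed_integralE f : signed_integrable nu f ->
  [/\ signed_integral_exists nu f,
    (power_measure m n).-integrable setT
      (fun t => (fine (f t) * \prod_i h i (tnth t i))%:E) &
    signed_integral nu f =
      (\int[power_measure m n]_t (fine (f t) * \prod_i h i (tnth t i)))%:E].
Proof.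
move=> fi; have [mf _] := fi; move/signed_integrableP : fi => /(_ mf) ifh.
pose M := power_measure m n.
have mw s : measurable_fun setT (fun t => (sign_weight s t)%:E).
  by apply/measurable_EFinP; exact: measurable_sign_weight.
have mphi : measurable_fun setT (fun t => fine (f t)) by exact: measurableT_comp.
have ifw s : M.-integrable setT (fun t => f t * (sign_weight s t)%:E)%E.
  apply: le_integrable ifh => //; first exact: emeasurable_funM.
  move=> t _; rewrite !abseM lee_wpmul2l// lee_fin ger0_norm ?sign_weight_le//.
  exact: sign_weight_ge0.
(* Infinite values become 0 under [fine], so absolute values can only decrease and integrability is
   preserved. *)
have fineM_le (x : \bar R) (w : R) : (`|(fine x * w)%:E| <= `|x * w%:E|)%E.
  by case: x => [r||]; [rewrite -EFinM|rewrite mul0r abse0|rewrite mul0r abse0].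
have iphi (w : n.-tuple B -> R) : measurable_fun setT w ->
    M.-integrable setT (fun t => f t * (w t)%:E)%E ->
    M.-integrable setT (fun t => (fine (f t) * w t)%:E).
  move=> w_m; apply: le_integrable => //.
  by apply/measurable_EFinP; exact: measurable_funM.
have ipart b s : M.-integrable setT (fun t => (sign_part b (fine (f t)) * sign_weight s t)%:E).
  apply: le_integrable (iphi _ (measurable_sign_weight s) (ifw s)) => //.
    apply/measurable_EFinP; apply: measurable_funM; last exact: measurable_sign_weight.
    exact: measurableT_comp (measurable_sign_part _) mphi.
  move=> t _ /=; rewrite lee_fin !normrM ler_wpM2r// ger0_norm ?sign_part_ge0//.
  rewrite -(sign_partD (fine _)); case: b; rewrite ?lerDl ?lerDr sign_part_ge0//.
have part b s : (\int[jordan_product nu s]_t (if b then f^\- t else f^\+ t) =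
    (\int[M]_t (sign_part b (fine (f t)) * sign_weight s t))%:E)%E.
  rewrite integral_jordan_product; last 2 first.
  - by case: b; [exact: measurable_funeneg|exact: measurable_funepos].
  - by move=> t; case: b; [exact: funeneg_ge0|exact: funepos_ge0].
  rewrite /Rintegral fineK; last exact: integrable_fin_num (ipart b s).
  apply: ae_eq_integral => //.
  - apply: emeasurable_funM => //.
    by case: b; [exact: measurable_funeneg|exact: measurable_funepos].
  - apply/measurable_EFinP; apply: measurable_funM; last exact: measurable_sign_weight.
    exact: measurableT_comp (measurable_sign_part _) mphi.
  (* Where the weight vanishes both sides are 0; elsewhere integrability makes [f] finite almost
     everywhere, and [fine] changes nothing. *)
  have := integrable_ae measurableT (ifw s); apply: filterS => t /(_ I) + _.
  have := sign_weight_ge0 s t; rewrite le_eqVlt => /orP[/eqP <-|w0].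
    by rewrite mulr0 !mule0.
  case ftE : (f t) => [r||]; last 2 first.
  - by rewrite gt0_mulye ?lte_fin.
  - by rewrite gt0_mulNye ?lte_fin.
  move=> _; rewrite EFinM; congr (_ * _)%E.
  by case: b; rewrite /sign_part ?expr0 ?expr1 ?mul1r ?mulN1r ?funeposE ?funenegE ftE ?EFin_max.
pose a b s := \int[M]_t (sign_part b (fine (f t)) * sign_weight s t).
have posE : signed_integral_pos nu f =
    (\sum_(s | ~~ minus_sign s) a false s + \sum_(s | minus_sign s) a true s)%:E.
  rewrite /signed_integral_pos EFinD -!sumEFin; congr (_ + _)%E.
    by apply: eq_bigr => s _; exact: (part false s).
  by apply: eq_bigr => s _; exact: (part true s).
have negE : signed_integral_neg nu f =
    (\sum_(s | ~~ minus_sign s) a true s + \sum_(s | minus_sign s) a false s)%:E.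
  rewrite /signed_integral_neg EFinD -!sumEFin; congr (_ + _)%E.
    by apply: eq_bigr => s _; exact: (part true s).
  by apply: eq_bigr => s _; exact: (part false s).
split.
- by rewrite /signed_integral_exists posE negE.
- by apply: iphi ifh; exact: measurable_prod_tnth.
rewrite /signed_integral posE negE -EFinB; congr EFin.
transitivity (\sum_s (-1) ^+ minus_sign s * \int[M]_t (fine (f t) * sign_weight s t)).
  have aE s : a false s - a true s = \int[M]_t (fine (f t) * sign_weight s t).
    rewrite /a -RintegralB//; [|exact: (ipart false s)|exact: (ipart true s)].
    apply: eq_Rintegral => t _.
    by rewrite -mulrBl sign_partB.
  rewrite [RHS](eq_bigr (fun s => (-1) ^+ minus_sign s * (a false s - a true s))); last first.
    by move=> s _; rewrite aE.
  rewrite [RHS](bigID (@minus_sign n))/= opprD addrACA addrC -!sumrB.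
  congr (_ + _); apply: eq_bigr => s sE; rewrite ?sE ?(negPf sE).
    by rewrite expr1 mulN1r opprB.
  by rewrite expr0 mul1r.
rewrite -Rintegral_sumZ//; last by move=> s; exact: iphi (measurable_sign_weight s) (ifw s).
apply: eq_Rintegral => t _; rewrite -sign_weight_sum mulr_sumr.
by apply: eq_bigr => s _; rewrite mulrCA.
Qed.

End Densities.

End SignedIntegral.

(** * Moments of the increments *)

Lemma prod_subr_expand (R : comNzRingType) n (a b : 'I_n -> R) :
  \prod_j (a j - b j) = \sum_(r : {ffun 'I_n -> bool})
    (\prod_j (-1) ^+ r j) * \prod_j (if r j then b j else a j).
Proof.
transitivity (\prod_j \sum_(c : bool) (-1) ^+ c * (if c then b j else a j)).
  by apply: eq_bigr => j _; rewrite big_bool/= expr1 expr0 mul1r mulN1r addrC.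
by rewrite bigA_distr_bigA; apply: eq_bigr => r _; rewrite big_split.
Qed.

(* [fine] maps infinite values to [0], and an infinite factor makes a product
   infinite or zero. *)
Lemma fine_prod (R : realType) (I : Type) (s : seq I) (P : pred I) (x : I -> \bar R) :
  fine (\prod_(i <- s | P i) x i)%E = \prod_(i <- s | P i) fine (x i).
Proof.
have fineMy (r : R) : fine (r%:E * +oo)%E = 0 /\ fine (r%:E * -oo)%E = 0.
  case: (ltgtP r 0) => [r0|r0|->]; last by rewrite !mul0e.
    by rewrite lt0_muley ?lte_fin// lt0_muleNy ?lte_fin.
  by rewrite gt0_muley ?lte_fin// gt0_muleNy ?lte_fin.
have fineMM (y z : \bar R) : fine (y * z)%E = fine y * fine z.
  case: y => [r||]; case: z => [q||] //.
  - by rewrite (fineMy r).1 mulr0.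
  - by rewrite (fineMy r).2 mulr0.
  - by rewrite muleC (fineMy q).1 mul0r.
  - by rewrite mulyy mul0r.
  - by rewrite mulyNy mul0r.
  - by rewrite muleC (fineMy q).2 mul0r.
  - by rewrite mulNyy mul0r.
  - by rewrite mulNyNy mul0r.
by elim: s => [|i s IH]; rewrite ?big_nil// !big_cons; case: (P i); rewrite ?fineMM ?IH.
Qed.

(** * Densities of two signed measures with respect to a common measure *)

Section CommonDensity.
Context (R : realType) (S : pmetricType R).
Notation B := (borel S).
Local Notation fmeasure := {finite_measure set B -> \bar R}.
Implicit Types (mu nu : signed_measure S) (h : B -> R).

Lemma common_dominating_measure mu nu : exists m : fmeasure,
  forall A, (m A = variation_measure mu A + variation_measure nu A)%E.
Proof.
pose a : {measure set B -> \bar R} := measure_add (variation_measure mu) (variation_measure nu).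
have aE A : (a A = variation_measure mu A + variation_measure nu A)%E.
  exact: measure_addE.
have fin_a : fin_num_fun a.
  by move=> A mA; rewrite aE fin_numD !fin_num_measure.
pose m : fmeasure := HB.pack (a : set _ -> \bar R) (Measure.on a)
  (@Measure_isFinite.Build _ _ _ a fin_a).
by exists m.
Qed.

Lemma density_of_dominated (m : fmeasure) nu :
  (forall A, measurable A -> m A = 0%E -> nu A = 0%E) -> exists h, has_density m nu h.
Proof.
move=> num; have dnu : nu `<< m by apply/null_content_dominatesP.
exists (fine \o Radon_Nikodym nu m).
have RNE : EFin \o (fine \o Radon_Nikodym nu m) = Radon_Nikodym nu m.
  by apply/funext => x /=; rewrite fineK// Radon_Nikodym_fin_num.
split; first by rewrite RNE; exact: Radon_Nikodym_integrable.
move=> A mA; rewrite (Radon_Nikodym_integral dnu mA).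
by apply: eq_integral => x _; rewrite -[in LHS]RNE.
Qed.

(** The sum of the two variations dominates both measures, and the Radon-Nikodym theorem applies. *)
Lemma common_density mu nu : exists (m : fmeasure) h1 h2,
  has_density m mu h1 /\ has_density m nu h2.
Proof.
have [m mE] := common_dominating_measure mu nu.
have m0 A : measurable A -> m A = 0%E -> mu A = 0%E /\ nu A = 0%E.
  move=> mA /eqP; rewrite mE padde_eq0// => /andP[/eqP mu0 /eqP nu0].
  move: mu0 nu0; rewrite !variation_measureE => mu0 nu0.
  have := abse_charge_variation (hahn mu) mA; have := abse_charge_variation (hahn nu) mA.
  rewrite -/(Defs.variation mu) -/(Defs.variation nu) mu0 nu0.
  by move=> nuA muA; split; apply/eqP; rewrite -abse_eq0 eq_le abse_ge0 andbT.
have [h1 h1P] := density_of_dominated (fun A mA A0 => (m0 A mA A0).1).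
have [h2 h2P] := density_of_dominated (fun A mA A0 => (m0 A mA A0).2).
by exists m, h1, h2.
Qed.

Lemma has_density_csub (m : fmeasure) mu nu h1 h2 :
  has_density m mu h1 -> has_density m nu h2 ->
  has_density m (csub mu nu) (fun x => h1 x - h2 x).
Proof.
move=> [ih1 muh] [ih2 nuh]; split.
  rewrite (_ : EFin \o _ = (EFin \o h1) \- (EFin \o h2))%E; last by apply/funext.
  exact: integrableB.
move=> A mA; rewrite [LHS](_ : _ = mu A + (-1)%:E * nu A)%E//.
rewrite mulN1e muh// nuh// -integralB//.
- exact: integrableS ih1.
- exact: integrableS ih2.
Qed.

End CommonDensity.

(** * Multilinear expansion for a difference of two measures *)

Section Moments.
Context (R : realType) (S : pmetricType R).
Notation B := (borel S).
Context (m : {finite_measure set B -> \bar R}) (u : S -> S -> \bar R).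
Context (mu nu : signed_measure S) (h1 h2 : B -> R).
Hypotheses (mu_h1 : has_density m mu h1) (nu_h2 : has_density m nu h2).
Hypothesis u_meas : measurable_fun setT (fun p : B * B => u p.1 p.2).

Let pick (b : bool) := if b then nu else mu.
Let hpick (b : bool) := if b then h2 else h1.

Hypothesis u_int : forall n (s : 'I_n -> 'I_n) (r : {ffun 'I_n -> bool}),
  (1 < n)%N -> derangement s ->
  signed_integrable (fun j => pick (r j)) (perm_integrand u s).

Let lambda := csub mu nu.
Let hl x := h1 x - h2 x.
Let lambda_h : has_density m lambda hl.
Proof. exact: has_density_csub. Qed.

Let pick_h b : has_density m (pick b) (hpick b).
Proof. by case: b. Qed.

(** Each vertex is the first argument of exactly one factor, so absorbing the density of [mu - nu]
    there puts it once on every variable. [fine] replaces the infinite values of [u] by 0. *)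
Definition density_kernel (x y : B) : R := fine (u x y) * (h1 x - h2 x).

Lemma fine_perm_integrand n (s : 'I_n -> 'I_n) (g : 'I_n -> B -> R) (t : n.-tuple B) :
  fine (perm_integrand u s t) * \prod_j g j (tnth t j) =
  \prod_j (fine (u (tnth t j) (tnth t (s j))) * g j (tnth t j)).
Proof. by rewrite fine_prod big_split. Qed.

(** The product of the densities h_1 - h_2 is a signed sum of mixed products, hence is dominated by
    the sum of their absolute values, each integrable against the kernels by [u_int]. *)
Lemma signed_integrable_csub n (s : 'I_n -> 'I_n) : (1 < n)%N -> derangement s ->
  signed_integrable (fun=> lambda) (perm_integrand u s).
Proof.
move=> n1 ds; have [mf _] := u_int [ffun=> false] n1 ds.
apply/(signed_integrableP (fun=> lambda_h) mf).
have ir (r : {ffun 'I_n -> bool}) : (power_measure m n).-integrable setT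
    (fun t => perm_integrand u s t * (\prod_j hpick (r j) (tnth t j))%:E)%E.
  by apply/(signed_integrableP (fun j => pick_h (r j)) mf); exact: u_int.
have isum : (power_measure m n).-integrable setT (fun t => \sum_(r : {ffun 'I_n -> bool})
    `|perm_integrand u s t * (\prod_j hpick (r j) (tnth t j))%:E|)%E.
  by apply: integrable_sum => // r _; exact: integrable_abse.
apply: le_integrable isum => //.
  apply: emeasurable_funM => //; apply/measurable_EFinP.
  apply: (@measurable_prod_tnth R S n (fun=> hl)) => j.
  exact: has_density_measurable lambda_h.
move=> t _; rewrite abseM [leRHS]gee0_abs; last by apply: sume_ge0.
rewrite [leRHS](eq_bigr (fun r : {ffun 'I_n -> bool} => `|perm_integrand u s t| *
    `|\prod_j hpick (r j) (tnth t j)|%:E)%E); last by move=> r _; rewrite abseM.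
rewrite -ge0_sume_distrr; last by [].
rewrite lee_wpmul2l// sumEFin lee_fin prod_subr_expand.
apply: (le_trans (ler_norm_sum _ _ _)); apply: ler_sum => r _.
rewrite normrM normr_prod big1 ?mul1r; last by move=> j _; rewrite normrX normrN1 expr1n.
rewrite le_eqVlt; apply/orP; left; apply/eqP; congr (`|_|).
by apply: eq_bigr => j _; rewrite /hpick; case: (r j).
Qed.

Lemma density_kernel_integrable : kernel_integrable m density_kernel.
Proof.
have mh := has_density_measurable lambda_h.
have mF : measurable_fun setT (fun p : B * B => density_kernel p.1 p.2).
  apply: measurable_funM; first exact: measurableT_comp u_meas.
  exact: measurableT_comp mh measurable_fst.
(* For n = 0 the integrand is the constant 1, and a single point has no derangement. *)
split => // -[|[|n]] s ds.
- under eq_fun do rewrite big_ord0.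
  apply: (@bmfun_integrable _ _ _ _ (fun=> 1)).
    by rewrite -ge0_fin_numE// fin_num_measure.
  by split => //; exists 1 => t; rewrite normr1.
- by have [_ /(_ ord0)] := ds; case: (s ord0) => -[]//= ? H; case: H; exact/val_inj.
have [_ + _] := signed_integralE (fun=> lambda_h) (signed_integrable_csub (isT : (1 < n.+2)%N) ds).
by apply: eq_integrable => // t _; rewrite (fine_perm_integrand s (fun=> hl)).
Qed.

Lemma signed_integral_csub n (s : 'I_n -> 'I_n) : (1 < n)%N -> derangement s ->
  signed_integral_exists (fun=> lambda) (perm_integrand u s) /\
  signed_integral (fun=> lambda) (perm_integrand u s) =
    (perm_integral m s (fun=> density_kernel))%:E.
Proof.
move=> n1 ds; have [ex _ ->] := signed_integralE (fun=> lambda_h) (signed_integrable_csub n1 ds).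
split => //; congr EFin; apply: eq_Rintegral => t _.
by rewrite (fine_perm_integrand s (fun=> hl)).
Qed.

Lemma perm_integral_sum_sign n (s : 'I_n -> 'I_n) : (1 < n)%N -> derangement s ->
  exists I : {ffun 'I_n -> bool} -> R,
    (forall r : {ffun 'I_n -> bool}, signed_integral (fun j => pick (r j)) (perm_integrand u s) = (I r)%:E) /\
    \sum_(r : {ffun 'I_n -> bool}) (\prod_j (-1) ^+ r j) * I r = perm_integral m s (fun=> density_kernel).
Proof.
move=> n1 ds.
exists (fun r => \int[power_measure m n]_t (fine (perm_integrand u s t) * \prod_j hpick (r j) (tnth t j))).
have iE (r : {ffun 'I_n -> bool}) := signed_integralE (fun j => pick_h (r j)) (u_int r n1 ds).
split=> [r|]; first by have [] := iE r.
rewrite -Rintegral_sumZ; last by move=> r; have [] := iE r.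
apply: eq_Rintegral => t _; rewrite -(fine_perm_integrand s (fun=> hl)) prod_subr_expand mulr_sumr.
apply: eq_bigr => r _; rewrite mulrCA; congr (_ * (_ * _)).
by apply: eq_bigr => j _; rewrite /hpick; case: (r j).
Qed.

End Moments.

(** * Differences of Radon measures and the bound from a proper norm *)

Section RadonMeasures.
Context (R : realType) (S : pmetricType R).
Notation B := (borel S).
Implicit Types (mu nu : signed_measure S).

Lemma charge_ext mu nu : (forall A, mu A = nu A) -> mu = nu.
Proof.
case: mu => f [m1 m2 m3]; case: nu => g [k1 k2 k3] /= /funext fg; case: _ / fg k1 k2 k3 => k1 k2 k3.
have -> : m1 = k1 by case: m1 => a; case: k1 => b; rewrite (Prop_irrelevance a b).
have -> : m2 = k2 by case: m2 => a; case: k2 => b; rewrite (Prop_irrelevance a b).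
by have -> : m3 = k3 by case: m3 => a; case: k3 => b; rewrite (Prop_irrelevance a b).
Qed.

Lemma variation_csub_le mu nu A : measurable A ->
  (Defs.variation (csub mu nu) A <= Defs.variation mu A + Defs.variation nu A)%E.
Proof.
move=> mA; have [m [h1 [h2 [mu1 nu2]]]] := common_density mu nu.
rewrite (variation_density (has_density_csub mu1 nu2))//.
rewrite (variation_density mu1)// (variation_density nu2)//.
have mh1 := has_density_measurable mu1; have mh2 := has_density_measurable nu2.
rewrite -ge0_integralD//; last 2 first.
- by apply: measurable_funTS; apply/measurable_EFinP; exact: measurableT_comp.
- by apply: measurable_funTS; apply/measurable_EFinP; exact: measurableT_comp.
apply: ge0_le_integral => //.
- apply: measurable_funTS; apply/measurable_EFinP; apply: measurableT_comp => //.
  exact: measurable_funB.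
- apply: measurable_funTS; apply: emeasurable_funD; apply/measurable_EFinP;
  exact: measurableT_comp.
- by move=> x _; rewrite -EFinD lee_fin ler_normB.
Qed.

Lemma compact_borel (K : set S) : compact K -> measurable (K : set B).
Proof.
move=> /(compact_closed (@metric_hausdorff _ S)) /closed_openC oK.
rewrite -[K]setCK; apply: measurableC; exact: sub_sigma_algebra.
Qed.

(** Properness of the norm speaks of Radon measures only, and is to be applied to differences. The
    union of two compact sets, each with error e / 2, is a suitable compact set. *)
Lemma radon_csub mu nu : radon_measures mu -> radon_measures nu ->
  radon_measures (csub mu nu).
Proof.
move=> [mu0 muK] [nu0 nuK]; split=> [A nA|A e mA e0].
  by rewrite [LHS](_ : _ = mu A + (-1)%:E * nu A)%E// mu0// nu0// mule0 adde0.
have e20 : 0 < e / 2 by rewrite divr_gt0.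
have [K1 [cK1 K1A muK1]] := muK A _ mA e20.
have [K2 [cK2 K2A nuK2]] := nuK A _ mA e20.
have mK1 := compact_borel cK1; have mK2 := compact_borel cK2.
exists (K1 `|` K2); split; [exact: compactU|by rewrite subUset|].
have mD : measurable (A `\` (K1 `|` K2) : set B).
  by apply: measurableD => //; exact: measurableU.
apply: (le_lt_trans (variation_csub_le mu nu mD)).
rewrite [e]splitr EFinD; apply: lteD.
- apply: le_lt_trans muK1; rewrite -!variation_measureE.
  by apply: le_measure; rewrite ?inE//; [exact: measurableD|apply: setDS; left].
- apply: le_lt_trans nuK2; rewrite -!variation_measureE.
  by apply: le_measure; rewrite ?inE//; [exact: measurableD|apply: setDS; right].
Qed.

(** By [perm_integral_le] only cyclic permutations matter; there the integral is a signed integral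
    against [mu - nu], which properness bounds. *)
Lemma perm_integral_density_le (m : {finite_measure set B -> \bar R}) (u : S -> S -> \bar R)
    mu nu h1 h2 (N : signed_measure S -> \bar R) (C q : R) :
  has_density m mu h1 -> has_density m nu h2 ->
  measurable_fun setT (fun p : B * B => u p.1 p.2) ->
  (forall n (s : 'I_n -> 'I_n) (r : {ffun 'I_n -> bool}), (1 < n)%N -> derangement s ->
    signed_integrable (fun j => if r j then nu else mu) (perm_integrand u s)) ->
  radon_measures mu -> radon_measures nu -> is_norm N -> 0 <= C ->
  (forall (n : nat) (rho : 'I_n -> signed_measure S), (2 <= n)%N ->
      (forall j, radon_measures (rho j)) ->
      signed_integral_exists rho (perm_integrand u (@ordS n)) ->
      `|signed_integral rho (perm_integrand u (@ordS n))|
        <= (C ^+ n)%:E * \prod_(j < n) N (rho j))%E ->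
  (N (csub mu nu) <= q%:E)%E ->
  forall n (s : 'I_n -> 'I_n), derangement s ->
  `|perm_integral m s (fun=> density_kernel u h1 h2)| <= (C * q) ^+ n.
Proof.
move=> mu1 nu2 mu_u ui rmu rnu [N0 _ _ _] C0 NC Nq n s ds.
have rl := radon_csub rmu rnu.
apply: (perm_integral_le (density_kernel_integrable mu1 nu2 mu_u ui) ds) => l l1.
have [ex sE] := signed_integral_csub mu1 nu2 ui l1 (derangement_ordS l1).
have := NC l (fun=> csub mu nu) l1 (fun=> rl) ex; rewrite sE => H.
rewrite -lee_fin; apply: (le_trans H).
rewrite exprMn EFinM lee_wpmul2l ?lee_fin ?exprn_ge0//.
have : (0 <= N (csub mu nu))%E by exact: N0.
move: Nq; case: (N (csub mu nu)) => [d||]//; rewrite !lee_fin => dq d0.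
by rewrite prodEFin lee_fin prodr_const card_ord lerXn2r// nnegrE// (le_trans d0).
Qed.

End RadonMeasures.

(** The integral is the difference of those of the positive and negative parts, and such a
    difference is finite only if both terms are. *)
Lemma integrable_fin_integral (R : realType) d (X : measurableType d)
    (mu : {measure set X -> \bar R}) (f : X -> \bar R) :
  measurable_fun setT f -> (\int[mu]_x f x)%E \is a fin_num -> mu.-integrable setT f.
Proof.
move=> mf; rewrite integralE fin_numB => /andP[fp fn]; apply/integrableP; split => //.
rewrite (_ : (fun x => `|f x|%E) = (f^\+ \+ f^\-)%E); last by rewrite -fune_abse.
rewrite ge0_integralD//; [|exact: measurable_funepos|exact: measurable_funeneg].
by apply: lte_add_pinfty; rewrite -ge0_fin_numE//; apply: integral_ge0.
Qed.

(** * Moments of the increments of the field *)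

Section PermanentalMoments.
Context (R : realType) (S : pmetricType R) (u : S -> S -> \bar R)
  (d : measure_display) (Omega : measurableType d) (P : probability Omega R)
  (alpha : R) (V : set (signed_measure S)) (psi : V -> {RV P >-> R}).
Notation B := (borel S).
Hypotheses (u_kernel : is_kernel u) (psi_perm : permanental_field alpha u psi).

Lemma permanental_integrable n (s : 'I_n -> 'I_n) (rho : 'I_n -> V) :
  (1 < n)%N -> derangement s ->
  signed_integrable (fun j => val (rho j)) (perm_integrand u s).
Proof.
move=> n1 [si sd]; have [_ _ /(_ n rho n1)[/(_ (perm si)) + _]] := psi_perm.
have pE : perm si = s :> ('I_n -> 'I_n) by apply/funext => j; rewrite permE.
by rewrite pE; apply => j; exact/eqP/sd.
Qed.

Lemma permanental_integrable_pick (mu nu : V) n (s : 'I_n -> 'I_n) (r : {ffun 'I_n -> bool}) :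
  (1 < n)%N -> derangement s ->
  signed_integrable (fun j => if r j then val nu else val mu) (perm_integrand u s).
Proof.
move=> n1 ds; rewrite (_ : (fun j => _) = (fun j => val (if r j then nu else mu))).
  exact: permanental_integrable.
by apply/funext => j; case: (r j).
Qed.

Lemma derangement_perm n (s : {perm 'I_n}) : [forall j, s j != j] -> derangement s.
Proof.
by move=> /forallP sd; split; [exact: perm_inj|move=> j; exact/eqP/sd].
Qed.

(** Expand the power into products of values at [mu] or [nu], apply the moment formula to each
    product, and exchange the sum over these choices with the sum over permutations. *)
Lemma permanental_moment (mu nu : V) (m : {finite_measure set B -> \bar R}) h1 h2 n :
  has_density m (val mu) h1 -> has_density m (val nu) h2 -> (1 < n)%N ->
  P.-integrable setT (fun w => ((psi mu w - psi nu w) ^+ n)%:E) /\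
  \int[P]_w ((psi mu w - psi nu w) ^+ n) =
    \sum_(s : {perm 'I_n} | [forall j, s j != j])
      alpha ^+ #|porbits s| * perm_integral m s (fun=> density_kernel u h1 h2).
Proof.
move=> mu1 nu2 n1.
pose rho (r : {ffun 'I_n -> bool}) j := if r j then nu else mu.
pose SI (s : {perm 'I_n}) r := signed_integral (fun j => val (rho r j)) (perm_integrand u s).
have SIP (s : {perm 'I_n}) : [forall j, s j != j] ->
    (forall r, SI s r \is a fin_num) /\
    \sum_(r : {ffun 'I_n -> bool}) (\prod_j (-1) ^+ r j) * fine (SI s r) =
      perm_integral m s (fun=> density_kernel u h1 h2).
  move=> /derangement_perm ds.
  have [I [IE <-]] := perm_integral_sum_sign mu1 nu2
     (@permanental_integrable_pick mu nu) n1 ds.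
  have SIE r : SI s r = (I r)%:E.
    rewrite /SI -IE; congr signed_integral; apply/funext => j.
    by rewrite /rho; case: (r j).
  by split=> [r|]; [rewrite SIE|apply: eq_bigr => r _; rewrite SIE].
pose g r w := \prod_j psi (rho r j) w.
have mg r : measurable_fun setT (g r) by apply: measurable_prod => j _.
have gE r : (\int[P]_w (g r w)%:E = (\sum_(s : {perm 'I_n} | [forall j, s j != j])
    alpha ^+ #|porbits s| * fine (SI s r))%:E)%E.
  have [_ _ /(_ n (rho r) n1)[_]] := psi_perm.
  rewrite unlock => ->; rewrite -sumEFin; apply: eq_bigr => s sd.
  by rewrite EFinM fineK//; exact: (SIP s sd).1.
have ig r : P.-integrable setT (fun w => (g r w)%:E).
  by apply: integrable_fin_integral; [exact/measurable_EFinP|rewrite gE].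
have XYE w : (psi mu w - psi nu w) ^+ n =
    \sum_(r : {ffun 'I_n -> bool}) (\prod_j (-1) ^+ r j) * g r w.
  rewrite -[n in LHS]card_ord -prodr_const prod_subr_expand; apply: eq_bigr => r _.
  congr (_ * _); apply: eq_bigr => j _.
  by rewrite /rho; case: (r j).
split.
  under eq_fun do rewrite XYE -sumEFin.
  apply: integrable_sum => // r _; under eq_fun do rewrite EFinM; exact: integrableZl.
under eq_Rintegral do rewrite XYE.
rewrite Rintegral_sumZ//.
under eq_bigr do rewrite /Rintegral gE/= mulr_sumr.
rewrite exchange_big/=; apply: eq_bigr => s sd.
rewrite -(SIP s sd).2 mulr_sumr; apply: eq_bigr => r _; exact: mulrCA.
Qed.

Lemma leq_card_porbits n (s : {perm 'I_n}) : (#|porbits s| <= n)%N.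
Proof. by rewrite -[leqRHS](card_ord n) leq_imset_card. Qed.

(** There are at most n! permutations, each with at most [n] cycles; the maximum with 1 allows the
    power of |alpha| to be raised to the exponent [n]. *)
Lemma permanental_moment_le (mu nu : V) (N : signed_measure S -> \bar R) (C q : R) n :
  is_norm N -> 0 <= C -> 0 <= q ->
  (forall (n : nat) (rho : 'I_n -> signed_measure S), (2 <= n)%N ->
      (forall j, radon_measures (rho j)) ->
      signed_integral_exists rho (perm_integrand u (@ordS n)) ->
      `|signed_integral rho (perm_integrand u (@ordS n))|
        <= (C ^+ n)%:E * \prod_(j < n) N (rho j))%E ->
  (N (csub (val mu) (val nu)) <= q%:E)%E -> (1 < n)%N ->
  P.-integrable setT (fun w => ((psi mu w - psi nu w) ^+ n)%:E) /\
  \int[P]_w ((psi mu w - psi nu w) ^+ n) <=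
    n`!%:R * (Num.max 1 `|alpha| * C * q) ^+ n.
Proof.
move=> Nn C0 q0 NC Nq n1.
have [m [h1 [h2 [mu1 nu2]]]] := common_density (val mu) (val nu).
have [intXY ->] := permanental_moment mu1 nu2 n1; split => //.
have [Vr _ _] := psi_perm; have [mu_u _] := u_kernel.
have Vr' (x : V) : radon_measures (val x) by apply: Vr; exact: set_valP.
have := perm_integral_density_le mu1 nu2 mu_u (@permanental_integrable_pick mu nu)
  (Vr' mu) (Vr' nu) Nn C0 NC Nq.
move=> cycle.
pose K := Num.max 1 `|alpha|; have K1 : 1 <= K by rewrite le_max lexx.
have K0 : 0 <= K by exact: le_trans ler01 K1.
have Ka : `|alpha| <= K by rewrite le_max lexx orbT.
apply: (@le_trans _ _ (\sum_(s : {perm 'I_n} | [forall j, s j != j]) (K * C * q) ^+ n)).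
  apply: ler_sum => s sd; apply: (le_trans (ler_norm _)); rewrite normrM normrX.
  rewrite -(mulrA K) exprMn ler_pM//; last exact: cycle (derangement_perm sd).
  apply: (@le_trans _ _ (K ^+ #|porbits s|)).
    by rewrite lerXn2r// nnegrE.
  by rewrite ler_weXn2l// leq_card_porbits.
have X0 : 0 <= (K * C * q) ^+ n by rewrite exprn_ge0// !mulr_ge0.
rewrite big_mkcond/=; apply: (@le_trans _ _ (\sum_(s : {perm 'I_n}) (K * C * q) ^+ n)).
  by apply: ler_sum => s _; case: ifP.
by rewrite sumr_const mulr_natl (_ : #|_| = n`!)// -card_Sn; apply: eq_card => s; rewrite !inE.
Qed.

End PermanentalMoments.

(** exp |y| is at most exp y + exp (-y), whose series has only even powers, so the terms are
    nonnegative and no absolute moments enter. *)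
Lemma expR_norm_le_series (R : realType) (y : R) :
  ((expR `|y|)%:E <= \sum_(k <oo) (((1 + (-1) ^+ k) * (y ^+ k / k`!%:R))%:E))%E.
Proof.
pose c k : R := (1 + (-1) ^+ k) * (y ^+ k / k`!%:R).
have cE : c = (fun k => exp_coeff y k + exp_coeff (- y) k).
  by apply/funext => k; rewrite /c /exp_coeff/= (exprNn y) mulrDl mul1r mulrA.
have c_cvg : (\sum_(0 <= k < n) c k)%R @[n --> \oo] --> expR y + expR (- y).
  rewrite (_ : (fun n => _) = (fun n => series (exp_coeff y) n + series (exp_coeff (- y)) n)).
    by apply: cvgD; exact: is_cvg_series_exp_coeff.
  by apply/funext => n; rewrite cE big_split.
have -> : (\sum_(k <oo) (c k)%:E = (expR y + expR (- y))%:E)%E.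
  apply/cvg_lim => //; under eq_fun do rewrite sumEFin.
  by apply: cvg_EFin => //; exact: nearW.
rewrite lee_fin; case: (ger0P y) => _; first by rewrite lerDl expR_ge0.
by rewrite lerDr expR_ge0.
Qed.

(** Integrating the series term by term, the term of index k is at most 2 / 2^k, and these bounds
    add up to 4. *)
Lemma exp_moment_le (R : realType) d (Omega : measurableType d) (P : probability Omega R)
    (Z : Omega -> R) : measurable_fun setT Z ->
  (forall n, (1 < n)%N -> P.-integrable setT (fun w => (Z w ^+ n)%:E) /\
     \int[P]_w (Z w ^+ n) <= n`!%:R / 2 ^+ n) ->
  (\int[P]_w (expR `|Z w|)%:E <= 4%:E)%E.
Proof.
move=> mZ ZP.
pose c k w : \bar R := ((1 + (-1) ^+ k) * (Z w ^+ k / k`!%:R))%:E.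
have mc k : measurable_fun setT (c k).
  apply/measurable_EFinP; apply: measurable_funM => //.
  by apply: measurable_funM => //; exact: measurable_funX.
have c0 k w : (0 <= c k w)%E.
  rewrite lee_fin -signr_odd; have [ok|ok] := boolP (odd k).
    by rewrite expr1 subrr mul0r.
  rewrite expr0 mulr_ge0// divr_ge0// exprn_even_ge0//.
have mexp : measurable_fun setT (fun w => (expR `|Z w|)%:E).
  by apply/measurable_EFinP; do 2 apply: measurableT_comp => //.
apply: (@le_trans _ _ (\int[P]_w \sum_(k <oo) c k w)%E).
  apply: ge0_le_integral => //.
    exact: ge0_emeasurable_sum.
  by move=> w _; exact: expR_norm_le_series.
rewrite integral_nneseries//.
apply: (@le_trans _ _ (\sum_(k <oo) (4 / (2 ^ k.+1)%:R)%:E)%E); last first.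
  have := @epsilon_trick R (fun=> 0%E) 4 xpredT (fun=> lexx _) (ler0n _ _).
  under eq_eseriesr do rewrite add0e.
  by move=> /le_trans; apply; rewrite eseries0// add0e.
apply: lee_nneseries => [k _ _|k _]; first exact: integral_ge0.
have E4 : 4 / (2 ^ k.+1)%:R = 2 / 2 ^+ k :> R.
  by rewrite natrX exprS; field; rewrite expf_neq0.
(* The term k = 0 equals 2, the term k = 1 vanishes, and the moment bound applies from k = 2 on. *)
rewrite {}E4; case: k => [|[|k]].
- rewrite (_ : (\int[P]_w c 0%N w)%E = 2%:E) ?expr0 ?divr1//.
  rewrite (_ : c 0%N = fun=> 2%:E); last by apply/funext => w; rewrite /c !expr0 fact0 divr1 mulr1.
  rewrite integral_cst//.
  by rewrite -[RHS]mule1 -(probability_setT P).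
- rewrite [leLHS](_ : _ = 0%E) ?lee_fin ?divr_ge0 ?exprn_ge0//.
  by rewrite integral0_eq// => w _; rewrite /c expr1 subrr mul0r.
have [iZ Zle] := ZP k.+2 isT.
pose a : R := (1 + (-1) ^+ k.+2) / k.+2`!%:R.
have s0 : 0 <= 1 + (-1) ^+ k.+2 :> R.
  by rewrite -signr_odd; case: (odd _); rewrite ?expr0 ?expr1; lra.
have s2 : 1 + (-1) ^+ k.+2 <= 2 :> R.
  by rewrite -signr_odd; case: (odd _); rewrite ?expr0 ?expr1; lra.
have a0 : 0 <= a by rewrite divr_ge0.
have -> : (\int[P]_w c k.+2 w = a%:E * \int[P]_w (Z w ^+ k.+2)%:E)%E.
  by rewrite -integralZl//; apply: eq_integral => w _; rewrite -EFinM /c /a mulrCA mulrC mulrAC mulrA.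
rewrite -[X in (_ * X)%E]fineK ?integrable_fin_num// -EFinM lee_fin.
apply: (@le_trans _ _ (a * (k.+2`!%:R / 2 ^+ k.+2))); first by rewrite ler_wpM2l.
rewrite /a mulrA divfK; last by rewrite pnatr_eq0 -lt0n fact_gt0.
by rewrite ler_wpM2r ?invr_ge0 ?exprn_ge0.
Qed.

(** * Metric entropy *)

Lemma ereal_nonincreasing_measurable (R : realType) (D : set R) (f : R -> \bar R) :
  measurable D -> (forall x y, x <= y -> (f y <= f x)%E) -> measurable_fun D f.
Proof.
move=> mD fni; apply: (measurability (@ErealGenOInfty.G R)) => [|/= _ [_ [r ->] <-]].
  exact: ErealGenOInfty.measurableE.
apply: measurableI => //; apply: is_interval_measurable => s t/=.
rewrite !in_itv/= !andbT => _ rt y /andP[_ yt].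
by rewrite in_itv/= andbT (lt_le_trans rt)// fni.
Qed.

(** On the interval from r_(k+1) to r_k, of length r_k / 2, the function is at least f(r_k); these
    intervals are disjoint, which gives the sum with the factor 2. *)
Lemma integral_nonincreasing_ge (R : realType) (f : R -> \bar R) (r0 : R) (K M : nat) :
  0 < r0 -> (forall x, 0 <= f x)%E -> (forall x y, x <= y -> (f y <= f x)%E) ->
  (\sum_(K <= k < M) (r0 / 2 ^+ k)%:E * f (r0 / 2 ^+ k)%R <=
   2%:E * \int[lebesgue_measure]_(x in [set x : R | (0 <= x)%R /\ x%:E <= (r0 / 2 ^+ K)%:E]) f x)%E.
Proof.
move=> r00 f0 fni.
pose r k := r0 / 2 ^+ k; pose D k := [set x : R | 0 <= x /\ (x%:E <= (r k)%:E)%E].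
have DE k : D k = `[0, r k]%classic.
  by apply/seteqP; split=> x; rewrite /D/= in_itv/=; [case=> [-> xk]|move=> /andP[-> xk]].
have rS k : r k = 2 * r k.+1 by rewrite /r exprS; field; rewrite expf_neq0.
have r_gt0 k : 0 < r k by rewrite divr_gt0// exprn_gt0.
have mf A : measurable A -> measurable_fun A f.
  by move=> mA; exact: ereal_nonincreasing_measurable.
have step k : ((r k.+1)%:E * f (r k) + \int[lebesgue_measure]_(x in D k.+1) f x <=
    \int[lebesgue_measure]_(x in D k) f x)%E.
  have -> : D k = D k.+1 `|` `]r k.+1, r k]%classic.
    rewrite !DE; apply/seteqP; split=> x /=; rewrite !in_itv/=.
      move=> /andP[-> ->]; rewrite andbT; have [|] := leP x (r k.+1); [by left|by right].
    have := r_gt0 k.+1; rewrite [r k]rS => rk.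
    by case=> [/andP[x0 xk]|/andP[xk1 xk]]; apply/andP; split => //; lra.
  have mD : measurable (D k.+1) by rewrite DE.
  rewrite ge0_integral_setU//; last 2 first.
  - by apply: mf; apply: measurableU.
  - rewrite disj_set2E; apply/eqP/seteqP; split=> x //=; rewrite DE/= !in_itv/=.
    by move=> [/andP[_ xk] /andP[kx _]]; move: kx; rewrite ltNge xk.
  rewrite [leLHS]addeC; apply: leeD; first by [].
  rewrite [leLHS](_ : _ = \int[lebesgue_measure]_(x in `]r k.+1, r k]) f (r k))%E.
    apply: ge0_le_integral => //; first exact: mf.
    by move=> x /=; rewrite in_itv/= => /andP[_ xk]; exact: fni.
  rewrite integral_cst//= lebesgue_measure_itv/= lte_fin muleC.
  have := r_gt0 k.+1; rewrite [r k]rS => rk; rewrite ifT; last by lra.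
  by rewrite -EFinD; congr (_ * _%:E)%E; ring.
rewrite -/(D K); have [n] := ubnP (M - K)%N; elim: n K => // n IH K MKn.
have [MK|KM] := leqP M K.
  by rewrite big_geq// mule_ge0// ?lee_fin//; exact: integral_ge0.
rewrite big_ltn//; apply: (@le_trans _ _
  ((r K)%:E * f (r K) + 2%:E * \int[lebesgue_measure]_(x in D K.+1) f x)%E).
  by rewrite leeD2l// IH//; lia.
have -> : ((r K)%:E * f (r K) = 2%:E * ((r K.+1)%:E * f (r K)))%E.
  by rewrite muleA -EFinM -rS.
rewrite -ge0_muleDr; first by rewrite lee_pmul2l// lte_fin.
  by rewrite mule_ge0// lee_fin ltW.
by apply: integral_ge0 => x _; exact: f0.
Qed.

Lemma sum_disjoint_le (R : realType) d (X : measurableType d) (mu : {measure set X -> \bar R})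
    (I : Type) (s : seq I) (F : I -> set X) :
  (forall i, measurable (F i)) -> pairwise (fun i j => `[< F i `&` F j = set0 >]) s ->
  (\sum_(i <- s) mu (F i) <= mu setT)%E.
Proof.
move=> mF; have mU (t : seq I) : measurable (\big[setU/set0]_(i <- t) F i).
  by elim: t => [|i t IH]; rewrite ?big_nil// big_cons; exact: measurableU.
suff H : pairwise (fun i j => `[< F i `&` F j = set0 >]) s ->
    (\sum_(i <- s) mu (F i) = mu (\big[setU/set0]_(i <- s) F i))%E.
  by move=> /H ->; apply: le_measure; rewrite ?inE.
elim: s => [_|i s IH /= /andP[si /IH E]]; first by rewrite !big_nil measure0.
rewrite !big_cons E measureU//.
elim: s si {IH E} => [_|j s IH /= /andP[/asboolP ij /IH E]]; first by rewrite big_nil setI0.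
by rewrite big_cons setIUr ij E setU0.
Qed.

(** * Logarithms of inverse measures of balls *)

Section LogInverse.
Context (R : realType).
Implicit Types s t : \bar R.
Local Open Scope ereal_scope.

Lemma lne_inv_fin (w : R) : (0 < w)%R -> lne (w%:E^-1) = (- ln w)%:E.
Proof.
by move=> w0; rewrite inver gt_eqF// lne_EFin ?invr_gt0// lnV.
Qed.

Lemma lne_inv0 : lne ((0 : \bar R)^-1) = +oo.
Proof. by rewrite inve0. Qed.

Lemma lne_inv_ge0 s : 0 <= s <= 1 -> 0 <= lne (s^-1).
Proof.
case: s => [w||]; rewrite ?lee_fin => /andP[]//.
rewrite le_eqVlt => /orP[/eqP <-|w0 w1]; first by rewrite lne_inv0.
by rewrite lne_inv_fin// lee_fin oppr_ge0 -ln1 ler_ln ?posrE.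
Qed.

Lemma lne_inv_le s t : 0 <= s -> s <= t -> t <= 1 -> lne (t^-1) <= lne (s^-1).
Proof.
case: t => [w||]; case: s => [v||]//; rewrite !lee_fin => v0 vw w1.
move: v0; rewrite le_eqVlt => /orP[/eqP <-|v0]; first by rewrite lne_inv0 leey.
have w0 := lt_le_trans v0 vw.
by rewrite !lne_inv_fin// lee_fin lerN2 ler_ln ?posrE.
Qed.

End LogInverse.

(** * The distance of the norm and the measurability of its balls *)

Section NormDist.
Context (R : realType) (S : pmetricType R) (N : signed_measure S -> \bar R)
  (V : set (signed_measure S)).
Hypotheses (N_norm : is_norm N) (V_radon : V `<=` radon_measures (S:=S)).
Notation B := (borel S).
Implicit Types mu nu : signed_measure S.
Local Open Scope ereal_scope.

(** Non-Borel sets have value 0 by definition, so identities between charges can be checked in the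
    reals on every set. *)
Lemma radon_fin_num mu A : radon_measures mu -> mu A \is a fin_num.
Proof.
move=> [mu0 _]; have [mA|nA] := pselect (measurable (A : set B)).
  exact: fin_num_measure.
by rewrite mu0.
Qed.

Lemma norm_dist_sym mu nu : radon_measures mu -> radon_measures nu ->
  norm_dist N mu nu = norm_dist N nu mu.
Proof.
move=> rmu rnu; rewrite /norm_dist.
have -> : csub mu nu = (cscale (-1) (csub nu mu) : {charge set _ -> \bar R}).
  apply: charge_ext => A.
  rewrite [LHS](_ : _ = mu A + (-1)%:E * nu A)//.
  rewrite [RHS](_ : _ = (-1)%:E * (nu A + (-1)%:E * mu A))//.
  rewrite !mulN1e -(fineK (radon_fin_num A rmu)) -(fineK (radon_fin_num A rnu)).
  by rewrite -!EFinB -EFinN; congr EFin; ring.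
have [_ _ NZ _] := N_norm.
by rewrite NZ ?normrN1 ?mul1e//; exact: radon_csub.
Qed.

Lemma norm_dist_tri nu mu la : radon_measures mu -> radon_measures nu ->
  radon_measures la -> norm_dist N mu la <= norm_dist N mu nu + norm_dist N nu la.
Proof.
move=> rmu rnu rla; rewrite /norm_dist.
have -> : csub mu la = (cadd (csub mu nu) (csub nu la) : {charge set _ -> \bar R}).
  apply: charge_ext => A.
  rewrite [LHS](_ : _ = mu A + (-1)%:E * la A)//.
  rewrite [RHS](_ : _ = (mu A + (-1)%:E * nu A) + (nu A + (-1)%:E * la A))//.
  rewrite !mulN1e -(fineK (radon_fin_num A rmu)) -(fineK (radon_fin_num A rnu)).
  rewrite -(fineK (radon_fin_num A rla)).
  by rewrite -!EFinB -EFinD; congr EFin; ring.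
have [_ _ _ ND] := N_norm.
by apply: ND; exact: radon_csub.
Qed.

Lemma measurable_norm_ball nu (r : R) : V nu ->
  measurable (norm_ball N V nu r : set (norm_borel N V)).
Proof.
move=> Vnu; rewrite -[X in measurable X]setCK; apply: measurableC.
apply: sub_sigma_algebra => la Vla nla.
have rla : r%:E < norm_dist N la nu by rewrite ltNge; apply/negP => ?; apply: nla.
(* The distance may be infinite; any positive [e] will then do. *)
have [e e0 re] : exists2 e : R, (0 < e)%R & (r + e)%:E <= norm_dist N la nu.
  move: rla; case: (norm_dist N la nu) => [d||]//.
    rewrite lte_fin => rd; exists (d - r)%R; first by rewrite subr_gt0.
    by rewrite lee_fin; lra.
  by move=> _; exists 1%R => //; rewrite leey.
exists e => // mu Vmu mula [_ mur].
have := norm_dist_tri (V_radon Vla) (V_radon Vmu) (V_radon Vnu).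
apply/negP; rewrite -ltNge; apply: lt_le_trans re.
have [N0 _ _ _] := N_norm.
rewrite norm_dist_sym in mula; [|exact: V_radon..].
rewrite [(r + e)%R]addrC EFinD; apply: lte_leD => //.
rewrite ge0_fin_numE; first exact: le_lt_trans mur (ltry _).
by apply: N0; apply: radon_csub; exact: V_radon.
Qed.

End NormDist.

(** * Weights for the chaining from the entropy condition *)

Section EntropyWeights.
Context (R : realType) (S : pmetricType R) (N : signed_measure S -> \bar R)
  (V : set (signed_measure S)) (sigma : probability (norm_borel N V) R).
Hypotheses (N_norm : is_norm N) (V_radon : V `<=` radon_measures (S:=S)).
Hypothesis sigma_lim :
  entropy_integral sigma delta%:E @[delta --> 0^'+] --> 0%E.

Lemma entropy_weights : exists (r0 : R) (W : nat -> V -> R) (e : nat -> R),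
  [/\ 0 < r0, e @ \oo --> 0 & forall k x, 0 < W k x <= 1] /\
  [/\ forall k, exists2 c, 0 < c & forall x, c <= W k x,
      forall k s, pairwise (fun x y : V =>
          (2 * (r0 / 2 ^+ k))%:E < norm_dist N (val x) (val y))%E s ->
        \sum_(x <- s) W k x <= 1 &
      forall x K M, \sum_(K <= k < M) r0 / 2 ^+ k * - ln (W k x) <= e K].
Proof.
pose J (a : R) := entropy_integral sigma a%:E.
have Vr (x : V) : radon_measures (val x) by apply: V_radon; exact: set_valP.
have VV (x : V) : V (val x) by exact: set_valP.
(* Below [r0] the entropy integral is finite, so that its real value can be used. *)
have [r0 r00 r0J] : exists2 r0 : R, 0 < r0 & forall a, 0 < a <= r0 -> (J a < 1%:E)%E.
  have Jlt : \forall a \near 0^'+, (J a < 1%:E)%E.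
    by apply: (@sigma_lim [set x | (x < 1%:E)%E]); exact: open_ereal_lt'.
  have := Jlt; rewrite near_withinE => /nbhs_ballP[b /= b0 bJ].
  exists (b / 2) => [|a /andP[a0 ab]]; first by rewrite divr_gt0.
  by apply: bJ => //; rewrite /ball/= sub0r normrN gtr0_norm//; lra.
pose r k := r0 / 2 ^+ k.
have r_gt0 k : 0 < r k by rewrite divr_gt0// exprn_gt0.
have r_le k : r k <= r0 by rewrite ler_pdivrMr ?exprn_gt0// ler_peMr ?exprn_ege1 ?ler1n// ltW.
have Jr k : (J (r k) < 1%:E)%E by apply: r0J; rewrite r_gt0 r_le.
pose ball (x : V) a := sigma (norm_ball N V (val x) a).
have mball (x : V) a : measurable (norm_ball N V (val x) a : set (norm_borel N V)).
  exact: measurable_norm_ball.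
have ball01 x a : (0 <= ball x a <= 1%E)%E by rewrite measure_ge0/= probability_le1.
pose f x a := lne ((ball x a)^-1)%E.
have f0 x a : (0 <= f x a)%E by exact: lne_inv_ge0.
have fni x a b : a <= b -> (f x b <= f x a)%E.
  move=> ab; apply: lne_inv_le; first by case/andP: (ball01 x a).
    apply: le_measure; rewrite ?inE// => nu [Vnu nx]; split => //.
    by rewrite (le_trans nx)// lee_fin.
  by case/andP: (ball01 x b).
(* The factor 2 is that of the dyadic comparison [integral_nonincreasing_ge]. *)
pose e k := 2 * fine (J (r k)).
have fJ x K M : (\sum_(K <= k < M) (r k)%:E * f x (r k) <= (e K)%:E)%E.
  apply: (le_trans (integral_nonincreasing_ge K M r00 (f0 x) (fni x))).
  rewrite [leRHS]EFinM lee_pmul2l//.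
  set I := (X in (X <= _)%E); have IJ : (I <= J (r K))%E.
    by apply: ereal_sup_ubound; exists (val x).
  rewrite fineK//; rewrite ge0_fin_numE; first exact: lt_trans (Jr K) (ltry _).
  by apply: le_trans IJ; apply: integral_ge0 => a _; exact: f0.
pose W k x := fine (ball x (r k)).
have WE k x : ball x (r k) = (W k x)%:E.
  by rewrite fineK// fin_num_measure.
(* A ball of measure 0 would contribute an infinite logarithm to the finite bound [fJ]. *)
have W0 k x : 0 < W k x.
  rewrite lt_neqAle -[X in _ && X]lee_fin -WE; case/andP: (ball01 x (r k)) => -> _.
  rewrite andbT eq_sym; apply/eqP => Wk0.
  have := fJ x k k.+1; rewrite big_nat1 /f WE Wk0 lne_inv0 gt0_muley ?lte_fin//.
have fE k x : f x (r k) = (- ln (W k x))%:E by rewrite /f WE lne_inv_fin.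
have W1 k x : 0 < W k x <= 1.
  by rewrite W0/= -lee_fin -WE; case/andP: (ball01 x (r k)).
have W_ent x K M : \sum_(K <= k < M) r k * - ln (W k x) <= e K.
  rewrite -lee_fin -sumEFin; apply: le_trans (fJ x K M).
  by apply: lee_sum => k _; rewrite fE.
have W_low k : exists2 c, 0 < c & forall x, c <= W k x.
  (* The entropy bound at the single level [k] is uniform in [x] and, solved for the weight, gives
     this constant. *)
  exists (expR (- (e k / r k))) => [|x]; first exact: expR_gt0.
  rewrite -ler_ln ?posrE ?expR_gt0// expRK lerNl.
  rewrite ler_pdivlMr// mulrC.
  by have := W_ent x k k.+1; rewrite big_nat1.
have W_sep k s : pairwise (fun x y => (2 * r k)%:E < norm_dist N (val x) (val y))%E s ->
    \sum_(x <- s) W k x <= 1.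
  move=> ss; rewrite -lee_fin -sumEFin.
  apply: (@le_trans _ _ (sigma setT)); last by rewrite probability_setT.
  under eq_bigr do rewrite -WE.
  apply: (@sum_disjoint_le _ _ _ sigma _ s (fun x => norm_ball N V (val x) (r k))) => //.
  apply: sub_pairwise ss => x y rxy; apply/asboolP/seteqP; split=> // nu [[Vnu nx] [_ ny]].
  move: rxy; rewrite ltNge => /negP; apply.
  apply: (le_trans (norm_dist_tri N_norm (Vr x) (V_radon Vnu) (Vr y))).
  rewrite mulr2n mulrDl mul1r EFinD leeD//.
  by rewrite norm_dist_sym//; exact: V_radon.
have e0 : e @ \oo --> 0.
  rewrite -(mulr0 2); apply: cvgMr; apply: fine_cvg.
  have /cvge_at_rightP := sigma_lim; apply; split => //.
  rewrite -(mulr0 r0); apply: cvgMr; under eq_fun do rewrite -exprVn.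
  by apply: cvg_expr; rewrite ger0_norm; lra.
by exists r0, W, e.
Qed.

End EntropyWeights.

Lemma permanental_exp_moment (R : realType) (S : pmetricType R) (u : S -> S -> \bar R)
    d (Omega : measurableType d) (P : probability Omega R) (alpha : R)
    (V : set (signed_measure S)) (psi : V -> {RV P >-> R})
    (N : signed_measure S -> \bar R) :
  is_kernel u -> permanental_field alpha u psi -> proper_norm u N ->
  exists2 L : R, 0 < L & forall (x y : V) (q : R), 0 < q ->
    (norm_dist N (val x) (val y) <= q%:E)%E ->
    (\int[P]_w (expR (`|psi x w - psi y w| / (L * q)))%:E <= 4%:E)%E.
Proof.
move=> u_kernel psi_perm [N_norm [C C0 NC]].
(* After division by [L * q] the factor 2 turns the moment bound into n! / 2^n, and C + 1 keeps [L]
   positive when [C] is 0. *)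
pose L := 2 * (Num.max 1 `|alpha| * (C + 1)).
have K0 : 0 < Num.max 1 `|alpha| :> R by rewrite lt_max ltr01.
have L0 : 0 < L by rewrite !mulr_gt0// ltr_wpDl.
exists L => // x y q q0 xyq.
have Lq : 0 < L * q by rewrite mulr_gt0.
have := @exp_moment_le R d Omega P (fun w => (psi x w - psi y w) / (L * q)).
under eq_integral do rewrite normrM (ger0_norm (_ : 0 <= (L * q)^-1)) ?invr_ge0 ?ltW//.
apply.
  by apply: measurable_funM => //; exact: measurable_funB.
move=> n n1.
have [iXY XYle] := permanental_moment_le u_kernel psi_perm N_norm C0 (ltW q0) NC xyq n1.
have XYE w : ((psi x w - psi y w) / (L * q)) ^+ n = (L * q) ^- n * (psi x w - psi y w) ^+ n.
  by rewrite expr_div_n mulrC.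
split.
  by under eq_fun do rewrite XYE EFinM; exact: integrableZl.
under eq_Rintegral do rewrite XYE.
rewrite RintegralZl// mulrC ler_pdivrMr ?exprn_gt0//.
apply: (le_trans XYle); rewrite -[leRHS]mulrA ler_wpM2l// -exprVn -exprMn.
apply: lerXn2r; rewrite ?nnegrE.
- by rewrite !mulr_ge0// ltW.
- by rewrite mulr_ge0// ltW.
rewrite (_ : 2^-1 * (L * q) = Num.max 1 `|alpha| * (C + 1) * q); last by rewrite /L; field.
by rewrite ler_pM2r// ler_pM2l// lerDl.
Qed.

(** * Uniform continuity of permanental fields *)

Local Open Scope ereal_scope.

Theorem theorem1p2 (R : realType) (S : pmetricType R)
  (S_lc : locally_compact [set: S]) (S_2c : @second_countable S)
  (u : S -> S -> \bar R) (u_kernel : is_kernel u)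
  (d : measure_display) (Omega : measurableType d) (P : probability Omega R)
  (alpha : R) (V : set (signed_measure S)) (psi : V -> {RV P >-> R})
  (psi_perm : permanental_field alpha u psi)
  (N : signed_measure S -> \bar R) (N_proper : proper_norm u N)
  (V_fin : V `<=` finite_norm_measures N)
  (sigma_ex : exists sigma : probability (norm_borel N V) R,
    [/\ sigma V = 1,
        entropy_integral sigma (norm_diameter N V) < +oo &
        entropy_integral sigma delta%:E @[delta --> 0^'+] --> 0]) :
  exists psi' : V -> {RV P >-> R},
    version psi' psi /\
    {ae P, forall w, uniformly_continuous_on N (fun nu => psi' nu w)}.
Proof.
have [N_norm _] := N_proper; have [V_radon _ _] := psi_perm.
have Vr (x : V) : radon_measures (val x) by apply: V_radon; exact: set_valP.
have [sigma [_ _ sigma_lim]] := sigma_ex.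
have [r0 [W [e [[r00 e0 W01] [W_low W_sep W_ent]]]]] := entropy_weights N_norm V_radon sigma_lim.
have [L L0 psi_exp] := permanental_exp_moment u_kernel psi_perm N_proper.
have rho_sym (x y : V) := norm_dist_sym N_norm (Vr x) (Vr y).
have rho_tri (y x z : V) := norm_dist_tri N_norm (Vr x) (Vr y) (Vr z).
have [psi' [psi'E psi'c]] :=
  chaining L0 r00 rho_sym rho_tri W01 W_low W_sep W_ent e0 psi_exp.
by exists psi'.
Qed.
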